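(* Let $u_0\in W^{1,\infty}(\mathbb{R}^d)$ and assume $(\mathbf{H}_1)$, $(\mathbf{H}_2')$, $(\mathbf{H}_3)$, $(\mathbf{H}_4)$ and $(\mathbf{A}_1)$ (listed in the context). If in addition $a\in(C^0(\mathbb{R}^d\times\mathbb{R}^d))^d$, the condition $$\bigl(a(x,\nabla u^n_\varepsilon(x))-a(y,\nabla u^n_\varepsilon(y))\bigr)\cdot(x-y)\le C|x-y|^2,\qquad x,y\in\mathbb{R}^d,\ n=0,\dots,N,$$ is satisfied with a constant $C$ independent of $\varepsilon$ and $h$, and $C\,h<1$, then the solution of the implicit Euler scheme $$X^{n+1}=X^n+h\,a(X^{n+1},\nabla u^{n+1}_\varepsilon(X^{n+1})),\quad n=0,\dots,N-1,\qquad X^0=x\in\mathbb{R}^d,$$ is uniquely defined. Moreover, the flow $(n,x)\mapsto X^n(x)$ is locally bounded and Lipschitz continuous with respect to $(x,n)\in Q_h=\mathbb{R}^d\times\{0,\dots,N\}$, uniformly in $\varepsilon$.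
   Context: $d\ge1$, $T>0$, $Q_T=\mathbb{R}^d\times[0,T]$, $H:Q_T\times\mathbb{R}^d\to\mathbb{R}$, $(x,t,p)\mapsto H(x,t,p)$; $a:\mathbb{R}^d\times\mathbb{R}^d\to\mathbb{R}^d$, $(x,p)\mapsto a(x,p)$. For $N\in\mathbb{N}$, $h=T/N$ and $t^n=nh$. $H^*(x,t,\xi)=\sup_{p\in\mathbb{R}^d}\{\xi\cdot p-H(x,t,p)\}\in\mathbb{R}\cup\{+\infty\}$. Define $u^0=u_0$ and $u^{n+1}(x)=\inf_{\xi\in\mathbb{R}^d}\{u^n(x-\xi h)+h\,H^*(x,t^n,\xi)\}$ for $n=0,\dots,N-1$. Let $\rho_\varepsilon(x)=\varepsilon^{-d}\rho(x/\varepsilon)$, $\varepsilon>0$, with $\rho\in C_c^\infty(\mathbb{R}^d)$, $\rho\ge0$, $\int\rho=1$, and $u^n_\varepsilon=u^n*\rho_\varepsilon$ (convolution in $x$). $B(0,R)$ is the ball of radius $R$ centered at $0$. Assumptions: $(\mathbf{H}_1)$ $H$ is uniformly continuous on $Q_T\times B(0,R)$ for any $R>0$. $(\mathbf{H}_2')$ For any $R>0$, $\sup_{Q_T\times\overline B(0,R)}|H(x,t,p)|<+\infty$. $(\mathbf{H}_3)$ There is $\eta>0$ with $|H(x,t,p)-H(y,t,p)|\le\eta(1+|p|)|x-y|$ for all $t\in[0,T]$, $x,y,p\in\mathbb{R}^d$. $(\mathbf{H}_4)$ $H$ is convex in $p$ and satisfies one of: (i) there is $K>0$ with $\lim_{|p|\to\infty}H(x,t,p)/|p|=K$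 uniformly in $(x,t)\in Q_T$, and there is a positive function $\alpha\in L^\infty(\mathbb{R}^d)$ with $|H(x,t,p)-H(y,t,p)|\le\alpha(p)|x-y|$ uniformly on $Q_T\times\mathbb{R}^d$; (ii) $\lim_{|p|\to\infty}\inf_{(x,t)\in Q_T}H(x,t,p)/|p|=+\infty$. $(\mathbf{A}_1)$ $|a|\in L^\infty_x(\mathbb{R}^d;L^\infty_{loc,p}(\mathbb{R}^d))$, i.e. $a$ is (essentially) bounded on $\mathbb{R}^d\times B(0,R)$ for every $R>0$. *)

(* Defs.v *)
From HB Require Import structures.
From mathcomp Require Import all_boot all_order all_algebra.
From mathcomp Require Import all_classical all_reals all_analysis.

Set Implicit Arguments.
Unset Strict Implicit.
Unset Printing Implicit Defensive.

Import Order.TTheory GRing.Theory Num.Theory.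
Import numFieldNormedType.Exports.
Local Open Scope classical_set_scope.
Local Open Scope ring_scope.

Definition mx_display : measure_display -> measure_display.
Proof. exact. Qed.

Section mx_measurable.
Context {disp : measure_display} {T : measurableType disp} {m n : nat}.

(* For T = R this is the Borel sigma-algebra of R^(m * n). *)
Definition mx_coord_sets : set (set 'M[T]_(m, n)) :=
  [set A | exists i j, exists2 B : set T, measurable B &
    A = (fun M : 'M[T]_(m, n) => M i j) @^-1` B].

Definition mx_measurable : set (set 'M[T]_(m, n)) := <<s mx_coord_sets >>.

Lemma mx_measurable0 : mx_measurable set0.
Proof. exact: sigma_algebra0. Qed.

Lemma mx_measurableC A : mx_measurable A -> mx_measurable (~` A).
Proof. exact: sigma_algebraC. Qed.

Lemma mx_measurable_bigcup (F : (set 'M[T]_(m, n))^nat) :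
  (forall i, mx_measurable (F i)) -> mx_measurable (\bigcup_i F i).
Proof. exact: sigma_algebra_bigcup. Qed.

HB.instance Definition _ := @isMeasurable.Build (mx_display disp)
  'M[T]_(m, n) mx_measurable mx_measurable0 mx_measurableC mx_measurable_bigcup.

Lemma measurable_mx_coord i j :
  measurable_fun setT (fun M : 'M[T]_(m, n) => M i j).
Proof.
move=> _ B mB; rewrite setTI; apply: sub_sigma_algebra.
by exists i, j, B.
Qed.

Lemma measurable_fun_mx {d1} {T1 : measurableType d1}
    (f : T1 -> 'M[T]_(m, n)) :
  (forall i j, measurable_fun setT (fun x => f x i j)) ->
  measurable_fun setT f.
Proof.
move=> mf; apply: (measurability mx_coord_sets) => //.
move=> _ [_ [i [j [B mB ->]]] <-]; exact: mf.
Qed.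

End mx_measurable.

Section lebesgue_measure_Rn.
Context {R : realType}.

Definition row_cons n (z : R * 'rV[R]_n) : 'rV[R]_n.+1 :=
  \row_i oapp (fun j => z.2 ord0 j) z.1 (unlift ord0 i).

Definition row_uncons n (v : 'rV[R]_n.+1) : R * 'rV[R]_n :=
  (v ord0 ord0, \row_i v ord0 (lift ord0 i)).

Lemma row_unconsK n : cancel (@row_uncons n) (@row_cons n).
Proof.
move=> v; apply/rowP => i; rewrite mxE /=.
by case: unliftP => [j ->|->] //=; rewrite mxE.
Qed.

Lemma row_consK n : cancel (@row_cons n) (@row_uncons n).
Proof.
move=> [t v]; congr pair; first by rewrite mxE unlift_none.
by apply/rowP => i; rewrite !mxE liftK.
Qed.

Lemma measurable_row_cons n : measurable_fun setT (@row_cons n).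
Proof.
apply: measurable_fun_mx => i j; rewrite /row_cons.
case: (unliftP ord0 j) => [k ->|->].
  apply: (eq_measurable_fun (fun z : R * 'rV[R]_n => z.2 ord0 k)).
    by move=> z _; rewrite mxE liftK.
  by apply: (measurableT_comp (measurable_mx_coord ord0 k)).
apply: (eq_measurable_fun (fun z : R * 'rV[R]_n => z.1)).
  by move=> z _; rewrite mxE unlift_none.
exact: measurable_fst.
Qed.

Lemma measurable_row_uncons n : measurable_fun setT (@row_uncons n).
Proof.
apply: measurable_fun_pair => /=.
  exact: (measurable_mx_coord ord0 ord0).
apply: measurable_fun_mx => i j.
apply: (eq_measurable_fun (fun v : 'rV[R]_n.+1 => v ord0 (lift ord0 j))).
  by move=> v _; rewrite mxE.
exact: (measurable_mx_coord ord0 (lift ord0 j)).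
Qed.

Section leb_succ.
Context {n : nat} (mu : {sigma_finite_measure set 'rV[R]_n -> \bar R}).

Definition leb_succ : set 'rV[R]_n.+1 -> \bar R :=
  pushforward (@lebesgue_measure R \x mu)%E (@row_cons n).

Let leb_succ0 : leb_succ set0 = 0%E.
Proof. by rewrite /leb_succ /pushforward preimage_set0 measure0. Qed.

Let leb_succ_ge0 A : (0 <= leb_succ A)%E.
Proof. by rewrite /leb_succ /pushforward; exact: measure_ge0. Qed.

Let leb_succ_sigma_additive : semi_sigma_additive leb_succ.
Proof.
move=> F mF tF mUF; rewrite /leb_succ /pushforward preimage_bigcup.
apply: measure_semi_sigma_additive.
- by move=> n0; rewrite -[X in measurable X]setTI; exact: measurable_row_cons.
- apply/trivIsetP => /= i j _ _ ij; rewrite -preimage_setI.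
  by move/trivIsetP : tF => /(_ _ _ _ _ ij) ->//; rewrite preimage_set0.
- by rewrite -preimage_bigcup -[X in measurable X]setTI;
    exact: measurable_row_cons.
Qed.

HB.instance Definition _ := isMeasure.Build _ _ _
  leb_succ leb_succ0 leb_succ_ge0 leb_succ_sigma_additive.

Let leb_succ_sigma_finite : sigma_finite setT leb_succ.
Proof.
have /sigma_finiteP[F [TF ndF Foo]] := sigma_finiteT (@lebesgue_measure R).
have /sigma_finiteP[G [TG ndG Goo]] := sigma_finiteT mu.
exists (fun k => @row_uncons n @^-1` (F k `*` G k)).
  apply/seteqP; split=> // v _.
  have [k _ Fk] : (\bigcup_k F k) (row_uncons v).1 by rewrite -TF.
  have [l _ Gl] : (\bigcup_k G k) (row_uncons v).2 by rewrite -TG.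
  exists (maxn k l) => //; split.
    by move: Fk; exact/subsetPset/ndF/leq_maxl.
  by move: Gl; exact/subsetPset/ndG/leq_maxr.
move=> k; have [mF Fk] := Foo k; have [mG Gk] := Goo k; split.
  rewrite -[X in measurable X]setTI; apply: measurable_row_uncons => //.
  exact: measurableX.
rewrite /leb_succ /pushforward -comp_preimage.
rewrite (_ : _ \o _ = id) ?preimage_id; last exact/funext/row_consK.
by rewrite product_measure1E// lte_mul_pinfty// ge0_fin_numE.
Qed.

HB.instance Definition _ := @Measure_isSigmaFinite.Build _ _ _
  leb_succ leb_succ_sigma_finite.

End leb_succ.

(* Lebesgue measure on R^n, as the n-fold product of the one-dimensional one;
   leb_box below checks its value on boxes. *)
Fixpoint leb n : {sigma_finite_measure set 'rV[R]_n -> \bar R} :=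
  match n with
  | 0 => \d_(0 : 'rV[R]_0)
  | n'.+1 => leb_succ (leb n')
  end.


Lemma leb_box n (a b : 'rV[R]_n) : (forall i, a ord0 i <= b ord0 i) ->
  leb n [set v : 'rV[R]_n | forall i, v ord0 i \in `]a ord0 i, b ord0 i]] =
  (\prod_i (b ord0 i - a ord0 i))%:E.
Proof.
elim: n => [|n IH] in a b *.
  move=> _; rewrite big_ord0 /= diracE mem_set//=.
  by move=> [].
move=> ab; rewrite /= /leb_succ /pushforward /=.
transitivity ((@lebesgue_measure R \x leb n)%E
  (`]a ord0 ord0, b ord0 ord0]%classic `*`
    [set v : 'rV[R]_n | forall i, v ord0 i \in
      `](row_uncons a).2 ord0 i, (row_uncons b).2 ord0 i]])).
  congr (product_measure1 _ _ _); apply/seteqP; split=> [[t v] /= h|[t v] /= [h0 h]].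
    split=> [|i]; first by have := h ord0; rewrite mxE unlift_none.
    by have := h (lift ord0 i); rewrite !mxE liftK.
  move=> i; rewrite mxE; case: unliftP => [j ->|->] //=.
  by have := h j; rewrite !mxE.
rewrite product_measure1E//=; last first.
  rewrite (_ : mkset _ = \bigcap_(i in [set: 'I_n]) ((fun v : 'rV[R]_n => v ord0 i) @^-1`
     `](row_uncons a).2 ord0 i, (row_uncons b).2 ord0 i]%classic)); last first.
    by apply/seteqP; split=> v /= h i; [move=> _; apply: h|apply: h].
  apply: fin_bigcap_measurable => // i _.
  by rewrite -[X in measurable X]setTI; apply: measurable_mx_coord.
rewrite IH => [|i]; last by rewrite !mxE.
rewrite lebesgue_measure_itv/= lte_fin big_ord_recl.
under eq_bigr do rewrite !mxE.
case: ltP => [_|ba]; first by rewrite EFinM EFinB.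
have -> : b ord0 ord0 = a ord0 ord0 by apply/eqP; rewrite eq_le ba ab.
by rewrite subrr !mul0r mul0e.
Qed.

End lebesgue_measure_Rn.

Section euclidean.
Context {R : realType} {d : nat}.
Implicit Types u v : 'rV[R]_d.

(* The norm `|v| of the library on 'rV_d is the sup norm. *)
Definition dot u v : R := \sum_i u ord0 i * v ord0 i.

Definition enorm u : R := Num.sqrt (dot u u).

Definition partial (i : 'I_d) (f : 'rV[R]_d -> R) (x : 'rV[R]_d) : R :=
  'D_(delta_mx ord0 i) f x.

Definition grad (f : 'rV[R]_d -> R) (x : 'rV[R]_d) : 'rV[R]_d :=
  \row_i partial i f x.

Fixpoint Ck (k : nat) (f : 'rV[R]_d -> R) : Prop :=
  match k with
  | 0 => continuous f
  | k'.+1 => (forall x, differentiable f x) /\ forall i, Ck k' (partial i f)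
  end.

Definition Cc_infty (f : 'rV[R]_d -> R) : Prop :=
  (forall k, Ck k f) /\ compact (closure [set x | f x != 0]).

End euclidean.

(* Measurability in Lfun is Borel measurability; up to a null set this is
   Lebesgue measurability. *)
Definition Linfty {disp} {X : measurableType disp} {R : realType}
    (mu : {measure set X -> \bar R}) (f : X -> R) : Prop :=
  exists2 g : X -> R, g \in Lfun mu +oo%E & \forall x \ae mu, f x = g x.

(* W^{1,oo}(R^d), with weak derivatives. This says nothing about the values of u
   on a null set: the representative has to be fixed separately. *)
Definition W1infty {R : realType} {d : nat} (u : 'rV[R]_d -> R) : Prop :=
  Linfty (leb d) u /\
  forall i : 'I_d, exists g : 'rV[R]_d -> R, Linfty (leb d) g /\
    forall phi, Cc_infty phi ->
      \int[leb d]_x (u x * partial i phi x) = - \int[leb d]_x (g x * phi x).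

Section hypotheses.
Context {R : realType} {d : nat}.
Variables (T : R) (H : 'rV[R]_d -> R -> 'rV[R]_d -> R).
Variable a : 'rV[R]_d -> 'rV[R]_d -> 'rV[R]_d.

Definition hypH1 : Prop :=
  forall r : R, 0 < r -> forall e : R, 0 < e -> exists2 delta : R, 0 < delta &
    forall x y s t p q, 0 <= s <= T -> 0 <= t <= T ->
      enorm p < r -> enorm q < r ->
      enorm (x - y) < delta -> `|s - t| < delta -> enorm (p - q) < delta ->
      `|H x s p - H y t q| < e.

Definition hypH2' : Prop :=
  forall r : R, 0 < r ->
    (ereal_sup [set `|H z.1.1 z.1.2 z.2|%R%:E | z in
       [set z : 'rV[R]_d * R * 'rV[R]_d |
          (0 <= z.1.2 <= T)%R /\ (enorm z.2 <= r)%R]] < +oo)%E.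

Definition hypH3 : Prop :=
  exists2 eta : R, 0 < eta & forall x y t p, 0 <= t <= T ->
    `|H x t p - H y t p| <= eta * (1 + enorm p) * enorm (x - y).

Definition hypH4i : Prop :=
  (exists2 K : R, 0 < K & forall e : R, 0 < e -> exists M : R, forall x t p,
     0 <= t <= T -> M < enorm p -> `|H x t p / enorm p - K| < e) /\
  (exists alpha : 'rV[R]_d -> R,
     [/\ forall p, 0 < alpha p, Linfty (leb d) alpha &
      forall x y t p, 0 <= t <= T ->
        `|H x t p - H y t p| <= alpha p * enorm (x - y)]).

Definition hypH4ii : Prop :=
  forall A : R, exists M : R, forall p, M < enorm p ->
    (A%:E <= ereal_inf [set (H z.1 z.2 p / enorm p)%:E | z in
       [set z : 'rV[R]_d * R | (0 <= z.2 <= T)%R]])%E.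

Definition hypH4 : Prop :=
  (forall x t, 0 <= t <= T -> convex_function setT (H x t)) /\
  (hypH4i \/ hypH4ii).

Definition hypA1 : Prop :=
  forall r : R, 0 < r ->
    Linfty (leb d \x leb d)%E
      (fun z : 'rV[R]_d * 'rV[R]_d =>
         enorm (a z.1 z.2) * \1_[set p | enorm p < r] z.2).

End hypotheses.

Section scheme.
Context {R : realType} {d : nat}.
Variables (T : R) (H : 'rV[R]_d -> R -> 'rV[R]_d -> R).
Variables (u0 rho : 'rV[R]_d -> R) (N : nat).

Definition legendre x t xi : \bar R :=
  ereal_sup [set (dot xi p - H x t p)%:E | p in [set: 'rV[R]_d]].

Definition step : R := T / N%:R.

Fixpoint discrete_value (n : nat) (x : 'rV[R]_d) : \bar R :=
  match n with
  | 0 => (u0 x)%:E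
  | n'.+1 => ereal_inf
      [set (discrete_value n' (x - step *: xi) +
            step%:E * legendre x (n'%:R * step) xi)%E | xi in [set: 'rV[R]_d]]
  end.

Definition mollifier (eps : R) (x : 'rV[R]_d) : R :=
  (eps ^+ d)^-1 * rho (eps^-1 *: x).

(* The infima and the convolution are finite under the standing assumptions, so
   fine discards nothing. *)
Definition mollified_value (eps : R) (n : nat) (x : 'rV[R]_d) : R :=
  fine (\int[leb d]_y (discrete_value n y * (mollifier eps (x - y))%:E)%E).

Definition implicit_euler (a : 'rV[R]_d -> 'rV[R]_d -> 'rV[R]_d) (eps : R)
    (x : 'rV[R]_d) (X : 'I_N.+1 -> 'rV[R]_d) : Prop :=
  X ord0 = x /\
  forall n : 'I_N, X (lift ord0 n) = X (widen_ord (leqnSn N) n) +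
    step *: a (X (lift ord0 n))
              (grad (mollified_value eps n.+1) (X (lift ord0 n))).

End scheme.

(* Main.v *)
Require Import Defs.
From mathcomp Require Import all_boot all_order all_algebra.
From mathcomp Require Import ring lra.
From mathcomp Require Import all_classical all_reals all_analysis.
From mathcomp Require Import measurable_realfun ess_sup_inf.

Import Order.TTheory GRing.Theory Num.Theory.
Import numFieldNormedType.Exports.
Local Open Scope classical_set_scope.
Local Open Scope ring_scope.

(** One implicit step from [X^n] solves [F (X) = X^n] for
    [F (x) = x - h a(x, Du(x))], where [Du] is the gradient of the mollified
    value at time [n + 1]. The one-sided Lipschitz condition says that
    [<F x - F y, x - y> >= (1 - C h) |x - y|^2], so for [C h < 1] the map [F] is
    strongly monotone. Such a map is injective, with a Lipschitz inverse
    ([strongly_monotone_expand]), and if it is also continuous it is onto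
    ([strongly_monotone_surj], by induction on the dimension and the intermediate
    value theorem). This gives existence, uniqueness and, by iteration over the
    steps, the Lipschitz dependence on the starting point
    ([euler_contraction]). The bounds on [X^n] and on its increments in [n]
    follow from a bound on the velocity ([euler_increment]).

    It remains to see that [Du] is continuous, and bounded uniformly in [eps],
    so that the local bound on [a] applies. Both come from the fact that every
    [u^n] is bounded and Lipschitz. A bounded Lipschitz function has
    mollifications with the same Lipschitz constant
    ([mollification_lipschitz]) and with continuous gradients
    ([convolution_partial], [continuous_convolution]).

    The initial datum is Lipschitz because its mollifications are so,
    uniformly: their gradients are mollifications of the bounded weak gradient
    ([W1infty_lipschitz]). One step of the scheme preserves the property
    ([hopf_lax_step]): the conjugate of [H] is Lipschitz in [x], uniformly for
    controls in a ball ([legendre_lipschitz]), and controls outside a large ball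
    are never optimal. The number of steps is fixed, so the constants may depend
    on the time step, but never on [eps].

    The convolutions rest on the change of variables [y = b + c z] for the
    product measure ([leb_affine]) and on the fact that a set of full measure is
    dense ([ae_leb_nbhs]). *)

(** * Euclidean geometry of row vectors *)

Section euclidean_theory.
Context {R : realType} {d : nat}.
Implicit Types (u v w : 'rV[R]_d) (c : R).

Lemma dotC u v : dot u v = dot v u.
Proof. by apply: eq_bigr => i _; rewrite mulrC. Qed.

Lemma dotDl u v w : dot (u + v) w = dot u w + dot v w.
Proof.
by rewrite /dot -big_split; apply: eq_bigr => i _; rewrite mxE mulrDl.
Qed.

Lemma dotZl c u v : dot (c *: u) v = c * dot u v.
Proof.
by rewrite /dot mulr_sumr; apply: eq_bigr => i _; rewrite mxE mulrA.
Qed.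

Lemma dotNl u v : dot (- u) v = - dot u v.
Proof. by rewrite -scaleN1r dotZl mulN1r. Qed.

Lemma dotBl u v w : dot (u - v) w = dot u w - dot v w.
Proof. by rewrite dotDl dotNl. Qed.

Lemma dotDr u v w : dot u (v + w) = dot u v + dot u w.
Proof. by rewrite dotC dotDl !(dotC u). Qed.

Lemma dotZr c u v : dot u (c *: v) = c * dot u v.
Proof. by rewrite dotC dotZl dotC. Qed.

Lemma dotBr u v w : dot u (v - w) = dot u v - dot u w.
Proof. by rewrite dotC dotBl !(dotC u). Qed.

Lemma dot_ge0 u : 0 <= dot u u.
Proof. by apply: sumr_ge0 => i _; rewrite -expr2 sqr_ge0. Qed.

Lemma enorm_ge0 u : 0 <= enorm u.
Proof. exact: sqrtr_ge0. Qed.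

Lemma sqr_enorm u : enorm u ^+ 2 = dot u u.
Proof. by rewrite sqr_sqrtr// dot_ge0. Qed.

Lemma coord_le_enorm u i : `|u ord0 i| <= enorm u.
Proof.
rewrite -sqrtr_sqr ler_sqrt ?dot_ge0// /dot (bigD1 i)//= expr2 lerDl.
by apply: sumr_ge0 => j _; rewrite -expr2 sqr_ge0.
Qed.

Lemma enorm_eq0 u : enorm u = 0 -> u = 0.
Proof.
move=> u0; apply/rowP => i; apply/eqP; rewrite mxE -normr_le0 -u0.
exact: coord_le_enorm.
Qed.

Lemma dot_le u v : dot u v <= enorm u * enorm v.
Proof.
have [v0|v0] := eqVneq (dot v v) 0.
  have /enorm_eq0 -> : enorm v = 0 by rewrite /enorm v0 sqrtr0.
  by rewrite -(scale0r u) dotZr mul0r mulr_ge0// enorm_ge0.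
have vp : 0 < dot v v by rewrite lt_neqAle eq_sym v0 dot_ge0.
rewrite (le_trans (ler_norm _))// -ler_sqr ?nnegrE ?mulr_ge0 ?enorm_ge0//.
rewrite exprMn !sqr_enorm real_normK ?num_real//.
(* expanding 0 <= |<v,v> u - <u,v> v|^2 gives <v,v> times the claim *)
have := dot_ge0 (dot v v *: u - dot u v *: v).
rewrite !(dotBl, dotBr, dotZl, dotZr) (dotC v u) => h.
have : 0 <= dot v v * (dot u u * dot v v - dot u v ^+ 2).
  by apply: le_trans h _; rewrite le_eqVlt; apply/orP; left; apply/eqP; ring.
by rewrite pmulr_rge0// subr_ge0.
Qed.

Lemma enormD u v : enorm (u + v) <= enorm u + enorm v.
Proof.
rewrite -ler_sqr ?nnegrE ?addr_ge0 ?enorm_ge0//.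
rewrite sqr_enorm dotDl !dotDr (dotC v u) sqrrD !sqr_enorm.
have := dot_le u v; lra.
Qed.

Lemma enormZ c u : enorm (c *: u) = `|c| * enorm u.
Proof.
by rewrite /enorm dotZl dotZr mulrA -expr2 sqrtrM ?sqr_ge0// sqrtr_sqr.
Qed.

Lemma enormN u : enorm (- u) = enorm u.
Proof. by rewrite -scaleN1r enormZ normrN1 mul1r. Qed.

Lemma enorm0 : enorm (0 : 'rV[R]_d) = 0.
Proof. by rewrite -(scale0r 0) enormZ normr0 mul0r. Qed.

Lemma enormB u v : enorm (u - v) = enorm (v - u).
Proof. by rewrite -enormN opprB. Qed.

Lemma enorm_le_sum u : enorm u <= \sum_i `|u ord0 i|.
Proof.
rewrite -ler_sqr ?nnegrE ?sumr_ge0 ?enorm_ge0// sqr_enorm /dot expr2.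
rewrite mulr_suml ler_sum// => i _.
rewrite -[leLHS]ger0_norm ?normrM -?expr2 ?sqr_ge0// expr2 ler_wpM2l//.
by rewrite (bigD1 i)//= lerDl sumr_ge0.
Qed.

Lemma coord_le_norm u i : `|u ord0 i| <= `|u|.
Proof.
rewrite [leRHS]/Num.norm /= mx_normrE.
by apply/bigmax_geP; right; exists (ord0, i).
Qed.

Lemma enorm_le_norm u : enorm u <= d%:R * `|u|.
Proof.
apply: (le_trans (enorm_le_sum u)).
rewrite (_ : d%:R * `|u| = \sum_(i < d) `|u|); last first.
  by rewrite sumr_const card_ord mulr_natl.
by apply: ler_sum => i _; exact: coord_le_norm.
Qed.

Lemma norm_ltP u (e : R) : 0 < e ->
  (`|u| < e <-> forall i, `|u ord0 i| < e).
Proof.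
move=> e0; split=> [ue i|ue]; first exact: le_lt_trans (coord_le_norm u i) ue.
have : ball (0 : 'rV[R]_d) e u.
  by split=> // i j; rewrite mxE /ball /= sub0r normrN ord1.
by rewrite mx_norm_ball /ball_ /= sub0r normrN.
Qed.

Lemma norm_le_enorm u : `|u| <= enorm u.
Proof.
apply/ler_addgt0Pr => e e0; apply/ltW; apply/norm_ltP => [|i].
  by rewrite ltr_wpDl ?enorm_ge0.
by rewrite (le_lt_trans (coord_le_enorm u i))// ltrDl.
Qed.

Lemma cvg_row {S : Type} {F : set_system S} {FF : Filter F}
    (f : S -> 'rV[R]_d) (l : 'rV[R]_d) :
  (forall i, f s ord0 i @[s --> F] --> l ord0 i) -> f s @[s --> F] --> l.
Proof.
move=> fl; apply/cvgrPdist_lt => e e0.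
have /filter_forall : forall i, \forall s \near F, `|l ord0 i - f s ord0 i| < e.
  by move=> i; have /cvgrPdist_lt/(_ _ e0) := fl i.
apply: filterS => s h; apply/norm_ltP => // i; rewrite !mxE; exact: h.
Qed.

Lemma continuous_enorm : continuous (@enorm R d).
Proof.
move=> u; apply/(@cvgrPdist_le _ _ _ (nbhs u) (nbhs_filter u)) => e e0.
have d0 : 0 < d%:R + 1 :> R by rewrite ltr_wpDl.
have ed : 0 < e / (d%:R + 1) by rewrite divr_gt0.
have /(@cvgrPdist_le _ _ _ (nbhs u) (nbhs_filter u))/(_ _ ed) :
  v @[v --> u] --> u by exact: cvg_id.
apply: filterS => v /= uv.
have h : enorm (u - v) <= e.
  apply: (le_trans (enorm_le_norm _)).
  rewrite (@le_trans _ _ ((d%:R + 1) * `|u - v|)) ?ler_wpM2r// ?lerDl//.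
  by rewrite mulrC -ler_pdivlMr.
rewrite ler_norml; apply/andP; split.
  have := enormD (v - u) u; rewrite subrK (enormB v); lra.
by have := enormD (u - v) v; rewrite subrK; lra.
Qed.

End euclidean_theory.

(** * Strongly monotone maps are onto *)

Section monotone.
Context {R : realType}.

Lemma dot_row_cons n (s t : R) (v w : 'rV[R]_n) :
  dot (row_cons (s, v)) (row_cons (t, w)) = s * t + dot v w.
Proof.
rewrite /dot big_ord_recl; congr (_ + _); first by rewrite !mxE unlift_none.
by apply: eq_bigr => i _; rewrite !mxE liftK.
Qed.

Lemma row_consB n (s t : R) (v w : 'rV[R]_n) :
  row_cons (s, v) - row_cons (t, w) = row_cons (s - t, v - w).
Proof. by apply/rowP => i; rewrite !mxE; case: unliftP => [j _|_] //=; rewrite !mxE. Qed.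

Lemma row_unconsB n (v w : 'rV[R]_n.+1) :
  row_uncons (v - w) = ((row_uncons v).1 - (row_uncons w).1,
                        (row_uncons v).2 - (row_uncons w).2).
Proof. by rewrite /row_uncons !mxE; congr pair; apply/rowP => i; rewrite !mxE. Qed.

Lemma cvg_row_cons n {S : Type} {F : set_system S} {FF : Filter F}
    (f : S -> R) (g : S -> 'rV[R]_n) (a : R) (b : 'rV[R]_n) :
  f s @[s --> F] --> a -> g s @[s --> F] --> b ->
  row_cons (f s, g s) @[s --> F] --> row_cons (a, b).
Proof.
move=> fa gb; apply: cvg_row => i.
under eq_fun do rewrite !mxE; rewrite mxE.
case: unliftP => [j _|_] //=.
exact: (continuous_cvg _ (@coord_continuous _ _ _ ord0 j b) gb).
Qed.

Lemma continuous_row_uncons2 n :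
  continuous (fun v : 'rV[R]_n.+1 => (row_uncons v).2).
Proof.
move=> v; apply: (@cvg_row _ _ _ (nbhs v) (nbhs_filter v)) => i; rewrite mxE.
under eq_fun do rewrite !mxE; exact: coord_continuous.
Qed.

Definition strongly_monotone n (c : R) (F : 'rV[R]_n -> 'rV[R]_n) :=
  forall x y, c * enorm (x - y) ^+ 2 <= dot (F x - F y) (x - y).

Lemma strongly_monotone_expand n c (F : 'rV[R]_n -> 'rV[R]_n) x y :
  strongly_monotone n c F -> c * enorm (x - y) <= enorm (F x - F y).
Proof.
move=> Fm; have [e0|e0] := eqVneq (enorm (x - y)) 0.
  by rewrite e0 mulr0 enorm_ge0.
have ep : 0 < enorm (x - y) by rewrite lt_neqAle eq_sym e0 enorm_ge0.
have := le_trans (Fm x y) (dot_le _ _).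
by rewrite expr2 mulrA ler_pM2r.
Qed.

(** The intermediate value theorem applies on [[-r, r]] with
    [r = |y - g 0| / c]: the linear growth of [g] carries it past [y] on both
    sides before that distance. *)
Lemma strongly_increasing_surj (g : R -> R) (c y : R) : 0 < c -> continuous g ->
  (forall s t, c * (s - t) ^+ 2 <= (g s - g t) * (s - t)) -> exists s, g s = y.
Proof.
move=> c0 cg gm.
have grow s t : t <= s -> c * (s - t) <= g s - g t.
  rewrite le_eqVlt => /predU1P[->|ts]; first by rewrite !subrr mulr0.
  by have := gm s t; rewrite expr2 mulrA ler_pM2r ?subr_gt0.
pose r := (`|y - g 0|) / c.
have r0 : 0 <= r by rewrite divr_ge0// ltW.
have cr : c * r = `|y - g 0| by rewrite /r mulrC divfK// gt_eqF.
have h1 : g (- r) <= y.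
  have := grow 0 (- r); rewrite opprK add0r cr oppr_le0 => /(_ r0).
  have := ler_norm (g 0 - y); rewrite distrC; lra.
have h2 : y <= g r.
  have := grow r 0 r0; rewrite subr0 cr.
  have := ler_norm (y - g 0); lra.
have [| | |s _ gs] := @IVT R g (- r) r y.
- by rewrite (le_trans _ r0)// oppr_le0.
- exact: continuous_subspaceT.
- by rewrite ge_min le_max h1 h2 orbT.
- by exists s.
Qed.

(** Induction on the dimension, so that no fixed point theorem is needed.
    Freezing the first coordinate at [s] leaves a strongly monotone map in
    dimension [n], hence a unique [X s] that matches the last [n] coordinates of
    [y]; strong monotonicity makes [X] continuous. Along the curve
    [s |-> (s, X s)] the last [n] coordinates of [F] are constant, so the
    monotonicity of [F] makes its first coordinate a strongly increasing function
    of [s], which takes every value. *)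
Lemma strongly_monotone_surj n c (F : 'rV[R]_n -> 'rV[R]_n) : 0 < c ->
  continuous F -> strongly_monotone n c F -> forall y, exists x, F x = y.
Proof.
move=> c0; elim: n F => [|n IH] F cF mF y.
  by exists 0; apply/rowP => -[].
pose G s x := (row_uncons (F (row_cons (s, x)))).2.
have splitF s t v w : (F (row_cons (s, v)) - F (row_cons (t, w))) =
    row_cons ((row_uncons (F (row_cons (s, v)))).1 -
              (row_uncons (F (row_cons (t, w)))).1, G s v - G t w).
  by rewrite -[LHS]row_unconsK row_unconsB.
have mG s : strongly_monotone n c (G s).
  move=> v w; have := mF (row_cons (s, v)) (row_cons (s, w)).
  by rewrite splitF row_consB !sqr_enorm !dot_row_cons subrr !mulr0 !add0r.
have cG s : continuous (G s).
  move=> v; have h : row_cons (s, w) @[w --> v] --> row_cons (s, v).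
    apply: (@cvg_row_cons n _ (nbhs v) (nbhs_filter v)).
      exact: (@cvg_cst _ _ _ (nbhs v) (nbhs_filter v)).
    exact: cvg_id.
  exact: (continuous_comp (continuous_comp h (cF _))
                          (@continuous_row_uncons2 n _)).
have /choice[X GX] : forall s, exists x, G s x = (row_uncons y).2.
  by move=> s; exact: IH.
have cX : continuous X.
  move=> s; apply/cvgrPdist_le => e e0.
  have : enorm (G t (X s) - G s (X s)) @[t --> s] --> (0 : R).
    have <- : enorm (G s (X s) - G s (X s)) = 0 by rewrite subrr enorm0.
    have h : row_cons (t, X s) @[t --> s] --> row_cons (s, X s).
      by apply: cvg_row_cons; [exact: cvg_id|exact: cvg_cst].
    have h2 := continuous_comp (continuous_comp h (cF _))
                               (@continuous_row_uncons2 n _).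
    have h3 : {for s, continuous (fun t => G t (X s) - G s (X s))}.
      by apply: (@cvgB _ _ _ _ (nbhs_filter s)); [exact: h2|exact: cvg_cst].
    exact: (continuous_comp h3 (@continuous_enorm _ _ _)).
  move=> /cvgrPdist_le/(_ (c * e)); rewrite mulr_gt0// => /(_ isT).
  apply: filterS => t; rewrite sub0r normrN ger0_norm ?enorm_ge0// => ht.
  rewrite (le_trans (norm_le_enorm _))// -(ler_pM2l c0).
  apply: le_trans ht.
  rewrite (_ : G s (X s) = G t (X t)); last by rewrite !GX.
  exact: strongly_monotone_expand.
pose g s := (row_uncons (F (row_cons (s, X s)))).1.
have cg : continuous g.
  move=> s; have h : row_cons (t, X t) @[t --> s] --> row_cons (s, X s).
    by apply: cvg_row_cons; [exact: cvg_id|exact: cX].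
  exact: (continuous_comp (continuous_comp h (cF _))
                          (@coord_continuous _ _ _ ord0 ord0 _)).
have [s t|s gs] := @strongly_increasing_surj g c (row_uncons y).1 c0 cg.
  have := mF (row_cons (s, X s)) (row_cons (t, X t)).
  rewrite splitF !GX subrr row_consB sqr_enorm !dot_row_cons -expr2.
  rewrite -(scale0r (0 : 'rV[R]_n)) dotZl mul0r addr0 => h.
  by apply: le_trans h; rewrite ler_pM2l// lerDl dot_ge0.
exists (row_cons (s, X s)).
rewrite -[LHS]row_unconsK -[RHS]row_unconsK; congr row_cons.
by rewrite [LHS]surjective_pairing [RHS]surjective_pairing [X in (X, _)]gs [X in (_, X)]GX.
Qed.

End monotone.

(** * Borel sets and Lebesgue measure *)

Section borel.
Context {R : realType}.

Lemma measurable_coord n (i : 'I_n) :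
  measurable_fun setT (fun v : 'rV[R]_n => v ord0 i).
Proof. exact: measurable_mx_coord. Qed.

Lemma measurable_box n (I : 'I_n -> interval R) :
  measurable [set v : 'rV[R]_n | forall i, v ord0 i \in I i].
Proof.
rewrite (_ : mkset _ = \bigcap_(i in [set: 'I_n])
    ((fun v : 'rV[R]_n => v ord0 i) @^-1` [set` I i])); last first.
  by apply/seteqP; split=> v /= h i; [move=> _; apply: h|apply: h].
apply: fin_bigcap_measurable => // i _.
by rewrite -[X in measurable X]setTI; apply: measurable_coord.
Qed.

Lemma rat_approx (x e : R) : 0 < e -> exists q : rat, `|x - ratr q| < e.
Proof.
move=> e0; have /rat_in_itvoo[q] : x - e < x + e by lra.
by rewrite in_itv/= => /andP[h1 h2]; exists q; rewrite ltr_norml; lra.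
Qed.

Lemma open_measurable_rV n (U : set 'rV[R]_n) : open U -> measurable U.
Proof.
move=> oU.
(* U is the union of the rational cubes that it contains *)
pose B (q : 'rV[rat]_n * rat) := [set v : 'rV[R]_n | forall i, v ord0 i \in
  `]ratr (q.1 ord0 i) - ratr q.2, ratr (q.1 ord0 i) + ratr q.2[].
pose F q := if `[< B q `<=` U >] then B q else set0.
have -> : U = \bigcup_q F q.
  apply/seteqP; split=> [v Uv|v [q _]]; last first.
    by rewrite /F; case: asboolP => // BU; exact: BU.
  have /nbhs_ballP[e /= e0 eU] := open_nbhs_nbhs (conj oU Uv).
  have /rat_in_itvoo[r] : 0 < e / 2 by rewrite divr_gt0.
  rewrite in_itv/= => /andP[r0 re].
  have /choice[c hc] : forall i, exists q : rat, `|v ord0 i - ratr q| < ratr r.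
    by move=> i; exact: rat_approx.
  exists (\row_i c i, r) => //; rewrite /F.
  have Bv : B (\row_i c i, r) v.
    by move=> i; rewrite /= mxE in_itv/= -ltr_distlC distrC.
  case: asboolP => // -[] w Bw; apply: eU.
  rewrite mx_norm_ball /ball_ /=; apply/norm_ltP => // i.
  rewrite !mxE; have := Bw i; have := Bv i.
  rewrite /= !mxE !in_itv/= -!ltr_distlC => h1 h2.
  rewrite (_ : _ - _ = (v ord0 i - ratr (c i)) + (ratr (c i) - w ord0 i)).
    rewrite (le_lt_trans (ler_normD _ _))// [ltRHS]splitr.
    by rewrite ltrD// (lt_trans _ re)// distrC.
  by rewrite addrA subrK.
apply: countable_bigcupT_measurable => [|q]; first exact: countableP.
by rewrite /F; case: ifP => // _; exact: measurable_box.
Qed.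

Lemma continuous_measurable_rV n (f : 'rV[R]_n -> R) :
  continuous f -> measurable_fun setT f.
Proof.
move=> cf; apply: (measurability _ (measurable_realfun.RGenOpens.measurableE R)).
move=> _ [_ [a [b ->] <-]]; rewrite setTI; apply: open_measurable_rV.
have /continuousP := cf; apply; exact: interval_open.
Qed.

End borel.

(** The measurability proof is an argument because the image is a measure only
    thanks to it. *)
Definition scaled_image {d1 d2} {T1 : measurableType d1} {T2 : measurableType d2}
  {R : realType} (k : {nonneg R}) (m : {measure set T1 -> \bar R})
  (f : T1 -> T2) (mf : measurable_fun setT f) : {measure set T2 -> \bar R}.
Proof.
unshelve refine (mscale k (pushforward m f) : {measure set T2 -> \bar R}).
exact: mf.
Defined.

Lemma scaled_imageE d1 d2 (T1 : measurableType d1) (T2 : measurableType d2)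
    (R : realType) (k : {nonneg R}) (m : {measure set T1 -> \bar R})
    (f : T1 -> T2) (mf : measurable_fun setT f) (A : set T2) :
  scaled_image k m f mf A = (k%:num%:E * m (f @^-1` A))%E.
Proof. by []. Qed.

Lemma ge0_integral_scaled_image d1 d2 (T1 : measurableType d1)
    (T2 : measurableType d2) (R : realType) (k : {nonneg R})
    (m : {measure set T1 -> \bar R}) (f : T1 -> T2)
    (mf : measurable_fun setT f) (g : T2 -> \bar R) :
  measurable_fun setT g -> (forall x, 0 <= g x)%E ->
  (\int[scaled_image k m f mf]_x g x = k%:num%:E * \int[m]_x g (f x))%E.
Proof.
move=> mg g0; rewrite ge0_integral_mscale//; congr (_ * _)%E.
by rewrite ge0_integral_pushforward.
Qed.

Section affine.
Context {R : realType}.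
Local Open Scope ereal_scope.

Definition affine1 (b c t : R) : R := (b + c * t)%R.

Lemma measurable_affine1 b c : measurable_fun setT (affine1 b c).
Proof.
by apply: measurable_funD => //; apply: measurable_funM.
Qed.

Definition affine n (b : 'rV[R]_n) (c : R) (v : 'rV[R]_n) : 'rV[R]_n :=
  (b + c *: v)%R.

Lemma measurable_affine n b c : measurable_fun setT (@affine n b c).
Proof.
apply: measurable_fun_mx => i j; rewrite ord1.
under eq_fun do rewrite !mxE.
apply: measurable_funD => //; apply: measurable_funM => //.
exact: measurable_coord.
Qed.

Definition affine_pair n (b : R * 'rV[R]_n) (c : R) (z : R * 'rV[R]_n) :=
  (affine1 b.1 c z.1, affine n b.2 c z.2).

Lemma measurable_affine_pair n b c : measurable_fun setT (@affine_pair n b c).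
Proof.
apply: measurable_fun_pair => /=.
  exact: (measurableT_comp (measurable_affine1 _ _)).
exact: (measurableT_comp (measurable_affine _ _ _)).
Qed.

Lemma lebesgue_affine1 (b c : R) (A : set R) : c != 0%R -> measurable A ->
  lebesgue_measure A = `|c|%:E * lebesgue_measure (affine1 b c @^-1` A).
Proof.
move=> c0 mA.
have mf : @measurable_fun _ _ (measurableTypeR R) (measurableTypeR R)
  setT (affine1 b c) by exact: measurable_affine1.
transitivity (scaled_image (NngNum (normr_ge0 c)) (@lebesgue_measure R) _ mf A);
  last by [].
apply: lebesgue_measure_unique mA => {A}.
move=> _ [[x y] _ <-] /=; rewrite /mscale /pushforward /=.
rewrite lebesgue_measure_itv /= lte_fin.
have [c_gt0|c_lt0] := ltP 0%R c.
  rewrite [X in _ = _ * lebesgue_measure X](_ : _ = `]((x - b) / c)%R, ((y - b) / c)%R]%classic);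
    last first.
    apply/seteqP; split=> t; rewrite /affine1 /= !in_itv/=
      ltr_pdivrMr// ler_pdivlMr//; lra.
  rewrite lebesgue_measure_itv /= lte_fin ltr_pM2r ?invr_gt0// ltrD2r.
  case: ifPn => xy; last by rewrite mule0.
  rewrite -EFinB -EFinM gtr0_norm//; congr EFin; field; exact: lt0r_neq0.
have {c_lt0 c0}c0 : (c < 0)%R by rewrite lt_neqAle c0.
rewrite [X in _ = _ * lebesgue_measure X](_ : _ = `[((y - b) / c)%R, ((x - b) / c)%R[%classic);
  last first.
  apply/seteqP; split=> t; rewrite /affine1 /= !in_itv/=
    ler_ndivrMr// ltr_ndivlMr//; lra.
rewrite lebesgue_measure_itv /= lte_fin ltr_nM2r ?invr_lt0// ltrD2r.
case: ifPn => xy; last by rewrite mule0.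
rewrite -EFinB -EFinM ltr0_norm//; congr EFin; field; exact: ltr0_neq0.
Qed.

(** The measure of dimension [n + 1] is a product, and an affine map that acts
    by the same factor on every coordinate respects the product: uniqueness of
    the product measure reduces the claim to dimensions [1] and [n]. *)
Lemma leb_affine n (b : 'rV[R]_n) (c : R) (A : set 'rV[R]_n) :
  c != 0%R -> measurable A ->
  leb n A = (`|c| ^+ n)%:E * leb n (affine n b c @^-1` A).
Proof.
move=> c0; elim: n b A => [|n IH] b A mA.
  rewrite expr0 mul1e; congr (leb 0 _); apply/seteqP.
  by split=> v; rewrite /affine /= (_ : b + c *: v = v)%R//; apply/rowP => -[].
rewrite /= /leb_succ /pushforward /=.
have E : @row_cons R n @^-1` (affine n.+1 b c @^-1` A) =
    affine_pair n (row_uncons b) c @^-1` (@row_cons R n @^-1` A).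
  apply/seteqP; split=> -[t v]; rewrite /= (_ : affine _ _ _ _ =
    row_cons (affine_pair n (row_uncons b) c (t, v)))//; apply/rowP => i;
    rewrite !mxE; case: unliftP => [j ->|->] /=; rewrite ?mxE//=.
pose X : measurableType _ := (measurableTypeR R * 'rV[R]_n)%type.
have mf : @measurable_fun _ _ X X setT (affine_pair n (row_uncons b) c).
  exact: measurable_affine_pair.
transitivity (scaled_image (NngNum (exprn_ge0 n.+1 (normr_ge0 c)))
    (@lebesgue_measure R \x leb n) _ mf (@row_cons R n @^-1` A)).
  apply: product_measure_unique => [B D mB mD|]; last first.
    by rewrite -[X in measurable X]setTI; exact: measurable_row_cons.
  rewrite scaled_imageE /=.
  have -> : affine_pair n (row_uncons b) c @^-1` (B `*` D) =
    (affine1 (row_uncons b).1 c @^-1` B) `*`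
    (affine n (row_uncons b).2 c @^-1` D) by [].
  rewrite product_measure1E; last 2 first.
  - by rewrite -[X in measurable X]setTI; exact: measurable_affine1.
  - by rewrite -[X in measurable X]setTI; exact: measurable_affine.
  rewrite (lebesgue_affine1 (row_uncons b).1 _ _ c0 mB) (IH (row_uncons b).2 D mD).
  by rewrite exprS EFinM muleACA.
by rewrite scaled_imageE E.
Qed.

Lemma ge0_integral_leb_affine n (b : 'rV[R]_n) (c : R) (f : 'rV[R]_n -> \bar R) :
  c != 0%R -> measurable_fun setT f -> (forall x, 0 <= f x) ->
  \int[leb n]_x f x = (`|c| ^+ n)%:E * \int[leb n]_x f (b + c *: x)%R.
Proof.
move=> c0 mf f0.
rewrite (eq_measure_integral (scaled_image (NngNum (exprn_ge0 n (normr_ge0 c)))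
    (leb n) _ (measurable_affine n b c))); last first.
  by move=> A mA _; rewrite scaled_imageE; exact: leb_affine.
by rewrite ge0_integral_scaled_image.
Qed.

(** With [c = -1] this is the symmetry of the convolution, with [c = - eps] it
    turns a mollification into an average against a fixed kernel. *)
Lemma integral_leb_affine n (b : 'rV[R]_n) (c : R) (f : 'rV[R]_n -> \bar R) :
  c != 0%R -> measurable_fun setT f ->
  (leb n).-integrable setT (fun x => f (b + c *: x)%R) ->
  \int[leb n]_x f x = (`|c| ^+ n)%:E * \int[leb n]_x f (b + c *: x)%R.
Proof.
move=> c0 mf intf; rewrite integralE.
have mp : measurable_fun setT (f^\+) by exact: measurable_funepos.
have mn : measurable_fun setT (f^\-) by exact: measurable_funeneg.
rewrite (ge0_integral_leb_affine n b c _ c0 mp)//.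
rewrite (ge0_integral_leb_affine n b c _ c0 mn)//.
rewrite -muleBr//.
  by rewrite [in RHS]integralE; congr (_ * (_ - _)); apply: eq_integral => x _;
    rewrite !unlock.
apply: fin_num_adde_defl.
rewrite fin_numN (eq_integral (fun x => f (b + c *: x)%R)^\-).
  exact: integrable_neg_fin_num.
by move=> x _; rewrite !unlock.
Qed.

End affine.

(** * Null sets and essential bounds *)

Section null_sets.
Import HBNNSimple.
Context {R : realType}.

Lemma leb_box_gt0 n (x : 'rV[R]_n) (e : R) : 0 < e ->
  (0 < leb n [set v : 'rV[R]_n | forall i,
    v ord0 i \in `]((x - const_mx e) ord0 i)%R, ((x + const_mx e) ord0 i)%R]])%E.
Proof.
move=> e0; rewrite leb_box => [|i]; last by rewrite !mxE lerD2l; lra.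
by rewrite lte_fin; apply: prodr_gt0 => i _; rewrite !mxE; lra.
Qed.

Lemma nbhs_box n (x : 'rV[R]_n) (U : set 'rV[R]_n) : nbhs x U ->
  exists2 B, measurable B & [/\ B `<=` U, (0 < leb n B)%E & B x].
Proof.
move=> /nbhs_ballP[e /= e0 eU].
exists [set v : 'rV[R]_n | forall i, v ord0 i \in
    `](x - const_mx (e / 2)) ord0 i, (x + const_mx (e / 2)) ord0 i]].
  exact: measurable_box.
split; last 2 first.
- by apply: leb_box_gt0; rewrite divr_gt0.
- by move=> i; rewrite !mxE in_itv/=; apply/andP; split; lra.
move=> v Bv; apply: eU; rewrite mx_norm_ball /ball_ /=; apply/norm_ltP => // i.
by have := Bv i; rewrite !mxE in_itv/= ltr_norml; lra.
Qed.

(** Neighbourhoods have positive measure, so they meet every set of full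
    measure. This turns essential bounds on continuous functions into pointwise
    bounds. *)
Lemma ae_leb_nbhs n (P : 'rV[R]_n -> Prop) (x : 'rV[R]_n) (U : set 'rV[R]_n) :
  {ae leb n, forall v, P v} -> nbhs x U -> exists2 v, U v & P v.
Proof.
move=> [N [mN N0 PN]] /nbhs_box[B mB [BU B0 _]].
apply: contrapT => UP.
have BN : B `<=` N.
  by move=> v Bv; apply: PN => /= Pv; apply: UP; exists v => //; exact: BU.
by move: B0; rewrite ltNge -N0 le_measure ?inE.
Qed.

Lemma ae_leb2_nbhs n (P : 'rV[R]_n * 'rV[R]_n -> Prop)
    (x : 'rV[R]_n * 'rV[R]_n) (U : set ('rV[R]_n * 'rV[R]_n)) :
  {ae (leb n \x leb n)%E, forall v, P v} -> nbhs x U -> exists2 v, U v & P v.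
Proof.
move=> [N [mN N0 PN]] [[U1 U2] /= [/nbhs_box[B mB [BU B0 _]]]].
move=> /nbhs_box[D mD [DU D0 _]] UU.
apply: contrapT => UP.
have BN : B `*` D `<=` N.
  move=> v [Bv Dv]; apply: PN => /= Pv; apply: UP; exists v => //.
  by apply: UU; split; [exact: BU|exact: DU].
have : ((leb n \x leb n) (B `*` D) <= 0)%E.
  by rewrite -N0 le_measure ?inE//; exact: measurableX.
by rewrite product_measure1E// leNgt mule_gt0.
Qed.

Lemma Linfty_bounded d (X : measurableType d) (mu : {measure set X -> \bar R})
    (f : X -> R) : Linfty mu f -> exists M, {ae mu, forall x, `|f x| <= M}.
Proof.
move=> [g /andP[_ /set_mem]] /=; rewrite /finite_norm unlock /=.
case: ifPn => [mu0 ginf fg|mu0 _ _]; last first.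
  exists 0, setT; split=> //; apply/eqP; rewrite eq_le measure_ge0 andbT.
  by rewrite leNgt.
have [M gM] : exists M : R, {ae mu, forall x, (`|(g x)%:E| <= M%:E)%E}.
  have := ess_sup_ge mu (abse \o (EFin \o g)).
  move: ginf; case: (ess_sup _ _) => [r _|//|_] h; first by exists r.
  by exists 0; apply: filterS h => x; rewrite leeNy_eq.
exists M; apply: filterS2 fg gM => x ->; by rewrite lee_fin.
Qed.

(** Here [f] may fail to be measurable. This matters for a function that is only
    almost everywhere equal to a Borel one, such as a weak derivative. Every
    simple function below [f] is almost everywhere below [h]. *)
Lemma ae_le_integral_gen d (X : measurableType d)
    (mu : {measure set X -> \bar R}) (f h : X -> \bar R) :
  (forall x, 0 <= f x)%E -> (forall x, 0 <= h x)%E -> measurable_fun setT h ->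
  {ae mu, forall x, (f x <= h x)%E} ->
  (\int[mu]_x f x <= \int[mu]_x h x)%E.
Proof.
move=> f0 h0 mh fh; rewrite [leLHS]ge0_integralTE//.
apply: ge_ereal_sup => _ [k /= kf <-]; rewrite -integralT_nnsfun.
apply: ae_ge0_le_integral => //.
- by move=> x _; rewrite lee_fin; exact: fun_ge0.
- by apply/measurable_EFinP; exact: measurable_funPT.
- by apply: filterS fh => x fhx _; exact: le_trans (kf x) fhx.
Qed.

End null_sets.

(** * Compactly supported functions *)

Section compact_support.
Context {R : realType}.

Lemma continuous_affine_rV n (b : 'rV[R]_n) (s : R) :
  continuous (fun y : 'rV[R]_n => b + s *: y).
Proof.
move=> y; apply: (@cvgD _ _ _ _ (nbhs_filter y)).
  exact: (@cvg_cst _ _ _ (nbhs y) (nbhs_filter y)).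
apply: (@cvgZr _ _ _ _ (nbhs_filter y)); exact: cvg_id.
Qed.

Lemma continuous_comp_affine n (f : 'rV[R]_n -> R) (b : 'rV[R]_n) (s : R) :
  continuous f -> continuous (fun y : 'rV[R]_n => f (b + s *: y)).
Proof.
move=> cf y; exact: (continuous_comp (continuous_affine_rV n b s y) (cf _)).
Qed.

Lemma continuous_comp_sub n (f : 'rV[R]_n -> R) (x : 'rV[R]_n) :
  continuous f -> continuous (fun y : 'rV[R]_n => f (x - y)).
Proof.
move=> cf; rewrite (_ : (fun y => _) = (fun y => f (x + (-1) *: y))).
  exact: continuous_comp_affine.
by apply/funext => y; rewrite scaleN1r.
Qed.

(** A bounded support is a compact one in finite dimension; the radius is the
    form in which the estimates use it. *)
Definition Cc n (f : 'rV[R]_n -> R) :=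
  continuous f /\ exists M : R, forall x, M < `|x| -> f x = 0.

Lemma Cc_bounded n (f : 'rV[R]_n -> R) : Cc n f ->
  exists2 K, 0 < K & (forall x, `|f x| <= K) /\ (forall x, K < `|x| -> f x = 0).
Proof.
move=> [cf [M Mf]].
have cA : compact [set x : 'rV[R]_n | `|x| <= M].
  apply: bounded_closed_compact.
    exists M; split; first exact: num_real.
    by move=> y My x /= xM; rewrite (le_trans xM)// ltW.
  rewrite (_ : mkset _ = (fun x : 'rV[R]_n => `|x|) @^-1` [set y | y <= M])//.
  by apply: closed_comp => [x _|]; [exact: norm_continuous|exact: closed_le].
have := continuous_compact (continuous_subspaceT cf) cA.
move=> /compact_bounded[K [_ /(_ (K + 1))]].
rewrite ltrDl => /(_ ltr01) fK.
exists (`|K| + `|M| + 1); first by rewrite ltr_pwDr ?addr_ge0.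
split=> x; last first.
  move=> h; apply: Mf; apply: le_lt_trans h.
  have := ler_norm M; have := normr_ge0 K; lra.
have [xM|/Mf ->] := leP `|x| M; last by rewrite normr0 !addr_ge0.
have /(fK _) : (f @` [set x : 'rV[R]_n | `|x| <= M]) (f x) by exists x.
have := ler_norm K; have := normr_ge0 M; rewrite /=; lra.
Qed.

Lemma integrable_bounded_supp n (g : 'rV[R]_n -> R) (K : R) :
  measurable_fun setT g -> (forall x, `|g x| <= K) ->
  (forall x, K < `|x| -> g x = 0) -> (leb n).-integrable setT (EFin \o g).
Proof.
move=> mg gK gs.
pose c : 'rV[R]_n := const_mx (`|K| + 1).
pose A := [set v : 'rV[R]_n | forall i, v ord0 i \in `](- c) ord0 i, c ord0 i]].
have mA : measurable A by exact: measurable_box.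
have iA : (leb n).-integrable A (EFin \o g).
  apply: measurable_bounded_integrable => //.
  - suff lA : (leb n A < +oo)%E by exact: lA.
    rewrite leb_box ?ltry// => i; rewrite !mxE; have := normr_ge0 K; lra.
  - exact: measurable_funTS.
  - exists K; split; first exact: num_real.
    by move=> y Ky x _ /=; rewrite (le_trans (gK x))// ltW.
apply: eq_integrable ((integrable_mkcond _ mA).1 iA) => // x _.
rewrite /patch; case: ifPn => // /negP xA; rewrite /= gs//.
rewrite ltNge; apply/negP => xK; apply: xA; rewrite inE => i.
have := le_trans (coord_le_norm x i) xK; rewrite !mxE in_itv /= ler_norml.
have := ler_norm K; lra.
Qed.

Lemma Cc_integrable n (f : 'rV[R]_n -> R) : Cc n f ->
  (leb n).-integrable setT (EFin \o f).
Proof.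
move=> fc; have [K _ [fK fs]] := Cc_bounded n f fc.
apply: (integrable_bounded_supp n f K) => //.
by apply: continuous_measurable_rV; case: fc.
Qed.

Lemma Cc_comp_affine n (f : 'rV[R]_n -> R) b (s : R) : s != 0 ->
  Cc n f -> Cc n (fun y => f (b + s *: y)).
Proof.
move=> s0 [cf [M Mf]]; split; first exact: continuous_comp_affine.
exists ((`|M| + `|b|) / `|s|) => x; rewrite ltr_pdivrMr ?normr_gt0// => h.
apply: Mf; rewrite (le_lt_trans (ler_norm _))//.
have := ler_normB (b + s *: x) b; rewrite addrAC subrr add0r normrZ mulrC.
move: h; lra.
Qed.

Lemma Cc_norm n (f : 'rV[R]_n -> R) : Cc n f -> Cc n (fun x => `|f x|).
Proof.
move=> [cf [M Mf]]; split; last by exists M => x /Mf ->; rewrite normr0.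
by move=> x; exact: (continuous_comp (cf x) (@norm_continuous _ _ _)).
Qed.

Lemma Cc_comp_sub n (f : 'rV[R]_n -> R) x : Cc n f -> Cc n (fun y => f (x - y)).
Proof.
move=> fc; have := @Cc_comp_affine n f x (-1) _ fc; rewrite oppr_eq0 oner_eq0.
move=> /(_ isT); congr Cc; apply/funext => y; by rewrite scaleN1r.
Qed.

Lemma integrable_bounded_mul n (f g : 'rV[R]_n -> R) (B : R) :
  measurable_fun setT f -> (forall x, `|f x| <= B) -> Cc n g ->
  (leb n).-integrable setT (fun x => (f x * g x)%:E).
Proof.
move=> mf fB gc; have [K K0 [gK gs]] := Cc_bounded n g gc.
have B0 : 0 <= B by rewrite (le_trans _ (fB 0)).
apply: (integrable_bounded_supp n (fun x => f x * g x) (B * K + K)).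
- apply: measurable_funM => //; apply: continuous_measurable_rV; exact: gc.1.
- move=> x; rewrite normrM (@le_trans _ _ (B * K)) ?ler_pM// lerDl ltW//.
- move=> x h; rewrite gs ?mulr0// (le_lt_trans _ h)// lerDr mulr_ge0// ltW//.
Qed.

Lemma Rintegral_leb_affine n (b : 'rV[R]_n) (s : R) (f : 'rV[R]_n -> R) :
  s != 0 -> measurable_fun setT f ->
  (leb n).-integrable setT (fun x => (f (b + s *: x))%:E) ->
  \int[leb n]_x f x = `|s| ^+ n * \int[leb n]_x f (b + s *: x).
Proof.
move=> s0 mf intf; rewrite /Rintegral.
rewrite (integral_leb_affine n b s)//; last exact/measurable_EFinP.
rewrite fineM//; exact: integrable_fin_num.
Qed.

Lemma Rintegral_sub n (f : 'rV[R]_n -> R) (x : 'rV[R]_n) : Cc n f ->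
  \int[leb n]_y f (x - y) = \int[leb n]_y f y.
Proof.
move=> fc; rewrite [RHS](Rintegral_leb_affine n x (-1)) ?oppr_eq0 ?oner_eq0//.
- rewrite normrN1 expr1n mul1r; apply: eq_Rintegral => y _.
  by rewrite scaleN1r.
- by apply: continuous_measurable_rV; exact: fc.1.
- apply: (Cc_integrable n (fun y => f (x + (-1) *: y))).
  by apply: Cc_comp_affine => //; rewrite oppr_eq0 oner_eq0.
Qed.

End compact_support.

(** * Convolution *)

Section directional.
Context {R : realType}.

Lemma is_derive_line n (f : 'rV[R]_n -> R) (w v : 'rV[R]_n) (t : R) :
  derivable f (w + t *: v) v ->
  is_derive t 1 (fun s => f (w + s *: v)) ('D_v f (w + t *: v)).
Proof.
move=> df.
have E : (fun h : R => h^-1 *: (((fun s => f (w + s *: v)) \o shift t) (h *: 1)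
    - f (w + t *: v))) =
  (fun h : R => h^-1 *: ((f \o shift (w + t *: v)) (h *: v) - f (w + t *: v))).
  apply/funext => h /=; congr (_ *: (f _ - _)).
  by rewrite [h *: 1]mulr1 scalerDl addrCA.
by split; rewrite /derivable /derive E.
Qed.

Definition convolution n (f g : 'rV[R]_n -> R) (x : 'rV[R]_n) : R :=
  \int[leb n]_y (f y * g (x - y)).

(** Differentiation under the integral along the line through [x] of direction
    [v]. For parameters [t] in [(-1, 1)] the derivative of the integrand is
    dominated by a constant on the ball of radius [K + |x| + |v|], where [K]
    bounds the radius of the support of ['D_v g]: this ball contains all the
    translated supports. *)
Lemma is_derive_convolution n (f g : 'rV[R]_n -> R) (B : R) (x v : 'rV[R]_n) :
  measurable_fun setT f -> (forall y, `|f y| <= B) -> Cc n g ->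
  (forall z, derivable g z v) -> Cc n (fun z => 'D_v g z) ->
  is_derive x v (convolution n f g) (convolution n f (fun z => 'D_v g z) x).
Proof.
move=> mf fB gc dg dgc; have B0 : 0 <= B by rewrite (le_trans _ (fB 0)).
pose F (t : R) y := f y * g (x - y + t *: v).
have FE t y : F t y = f y * g ((t *: v + x) - y).
  by rewrite /F addrC [in RHS]addrC addrA addrC addrA (addrC (- y)).
have dF t y : is_derive t (1 : R) (F ^~ y) (f y * 'D_v g (x - y + t *: v)).
  by apply: is_deriveZ; exact: is_derive_line.
have d1E t y : partial1of2 F t y = f y * 'D_v g (x - y + t *: v).
  by rewrite partial1of2E; exact: derive_val.
have [K K0 [dgK dgs]] := Cc_bounded n _ dgc.
pose r := K + `|x| + `|v|.
pose A := [set y : 'rV[R]_n | `|y| <= r].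
have mA : measurable A.
  rewrite (_ : A = ~` [set y : 'rV[R]_n | r < `|y|]); last first.
    by apply/seteqP; split=> y /=; rewrite /A /= leNgt => /negP.
  apply: measurableC; apply: open_measurable_rV.
  rewrite (_ : mkset _ = (fun y : 'rV[R]_n => `|y|) @^-1` [set z | r < z])//.
  by apply: open_comp => [y _|]; [exact: norm_continuous|exact: open_gt].
pose G y := B * K * \1_A y.
have G0 y : 0 <= G y by rewrite /G !mulr_ge0// ltW.
have iG : (leb n).-integrable setT (EFin \o G).
  apply: (integrable_bounded_supp n G (B * K + r)).
  - by apply: measurable_funM => //; exact: measurable_indic.
  - move=> y; rewrite ger0_norm// /G indicE.
    have r0 : 0 <= r by rewrite !addr_ge0// ltW.
    by case: (_ \in _); rewrite ?mulr1 ?mulr0 ?lerDl// addr_ge0// mulr_ge0// ltW.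
  - move=> y h; rewrite /G indicE memNset ?mulr0// /A /=; apply/negP.
    by rewrite -ltNge (le_lt_trans _ h)// lerDr mulr_ge0// ltW.
have GF t y : `](-1 : R), 1[%classic t -> [set: 'rV[R]_n] y ->
    `|partial1of2 F t y| <= G y.
  rewrite /= in_itv/= -ltr_norml => t1 _; rewrite d1E normrM /G indicE.
  have [yA|yA] := boolP (y \in A); first by rewrite mulr1 ler_pM.
  rewrite dgs ?normr0 ?mulr0// ltNge; apply/negP => h.
  move/negP: yA; apply; rewrite inE /A /= /r.
  have -> : y = x + t *: v - (x - y + t *: v) by rewrite opprD addrACA opprB subrr addr0 addrC subrK.
  have tv : `|t *: v| <= `|v| by rewrite normrZ ler_piMl// ltW.
  have := ler_normB (x + t *: v) (x - y + t *: v).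
  have := ler_normD x (t *: v); lra.
have := @cvg_differentiation_under_integral R _ _ (leb n) F setT measurableT
  0 (-1) 1 _ _ _ G G0 iG GF.
have iF t : (leb n).-integrable setT (EFin \o F t).
  rewrite (_ : _ \o _ = (fun y => (f y * g ((t *: v + x) - y))%:E)); last first.
    by apply/funext => y /=; rewrite FE.
  apply: (integrable_bounded_mul n _ _ B) => //; exact: Cc_comp_sub.
move=> /(_ _ (fun t _ => iF t) _); rewrite /= in_itv/= oppr_lt0 ltr01.
move=> /(_ isT (fun t y _ _ => @ex_derive _ _ _ _ _ _ _ (dF t y))).
rewrite (_ : (fun h : R => _) = (fun h : R => h^-1 *: ((convolution n f g \o shift x) (h *: v) -
    convolution n f g x))); last first.
  apply/funext => h; congr (_ *: (_ - _)); apply: eq_Rintegral => y _.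
    by rewrite FE addr0.
  by rewrite FE scale0r add0r.
rewrite (_ : Rintegral _ _ _ = convolution n f (fun z => 'D_v g z) x); last first.
  by apply: eq_Rintegral => y _; rewrite d1E scale0r addr0.
move=> cv; apply: DeriveDef; last exact: cvg_lim cv.
by apply/cvg_ex; eexists; exact: cv.
Qed.

End directional.

(** * Smooth kernels *)

Section smooth.
Context {R : realType}.

Lemma continuous_nbhs_gt n (f : 'rV[R]_n -> R) (x : 'rV[R]_n) (M : R) :
  continuous f -> M < f x -> nbhs x [set y | M < f y].
Proof.
move=> cf Mf; have oM : open [set y | M < f y].
  rewrite (_ : mkset _ = f @^-1` [set z | M < z])//.
  by apply: open_comp => [y _|]; [exact: cf|exact: open_gt].
by apply: open_nbhs_nbhs; split.
Qed.

Lemma Cc_compact_support n (f : 'rV[R]_n -> R) : Cc n f ->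
  compact (closure [set x | f x != 0]).
Proof.
move=> [cf [M Mf]]; apply: bounded_closed_compact; last exact: closed_closure.
exists M; split; first exact: num_real.
move=> K MK x; apply: contraPP => /negP; rewrite -ltNge => Kx.
have : nbhs x [set y : 'rV[R]_n | M < `|y|].
  apply: continuous_nbhs_gt; first exact: norm_continuous.
  exact: lt_trans Kx.
move=> Nx /(_ _ Nx) [y [/= fy0 My]].
by move: fy0; rewrite Mf// eqxx.
Qed.

Lemma compact_support_bounded n (f : 'rV[R]_n -> R) :
  compact (closure [set x | f x != 0]) ->
  exists M : R, forall x, M < `|x| -> f x = 0.
Proof.
move=> /compact_bounded[M [_ Mf]]; exists (M + 1) => x Mx.
apply/eqP; apply: contraPT Mx => fx; apply/negP; rewrite -leNgt.
apply: Mf; first by rewrite ltrDl.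
exact: subset_closure.
Qed.

Lemma Cc_infty_Cc n (f : 'rV[R]_n -> R) : Cc_infty f -> Cc n f.
Proof.
by move=> [/(_ 0%N) cf /compact_support_bounded fs].
Qed.

Lemma Cc_infty_differentiable n (f : 'rV[R]_n -> R) x :
  Cc_infty f -> differentiable f x.
Proof. by move=> [/(_ 1%N)[df _] _]. Qed.

Lemma Cc_infty_derivable n (f : 'rV[R]_n -> R) x v :
  Cc_infty f -> derivable f x v.
Proof. by move=> /Cc_infty_differentiable df; exact: diff_derivable. Qed.

Lemma Cc_partial n (f : 'rV[R]_n -> R) i : Cc_infty f -> Cc n (partial i f).
Proof.
move=> [Cf /compact_support_bounded[M Mf]]; split; first exact: (Cf 1%N).2.
exists M => x Mx; rewrite /partial.
rewrite -(@derive_cst _ _ _ (0 : R) x (delta_mx ord0 i)).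
apply: near_eq_derive.
have : nbhs x [set y : 'rV[R]_n | M < `|y|].
  by apply: continuous_nbhs_gt => //; exact: norm_continuous.
by apply: filterS => y /Mf.
Qed.

Lemma Cc_infty_partial n (f : 'rV[R]_n -> R) i :
  Cc_infty f -> Cc_infty (partial i f).
Proof.
move=> fc; split=> [k|]; first exact: (fc.1 k.+1).2.
exact: Cc_compact_support (Cc_partial n f i fc).
Qed.

Lemma Ck_affine k n (f : 'rV[R]_n -> R) (c s : R) (b : 'rV[R]_n) :
  Ck k f -> Ck k (fun y => c * f (b + s *: y)).
Proof.
elim: k f c => [|k IH] f c /=.
  move=> cf y; apply: (@cvgMl_tmp _ _ _ (nbhs_filter y)).
  exact: continuous_comp_affine.
move=> [df Cf].
have da y : differentiable (fun y : 'rV[R]_n => b + s *: y) y.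
  by apply: differentiableD => //; apply: differentiableZ.
have dF y : differentiable (fun y => c * f (b + s *: y)) y.
  apply: differentiableZ; exact: (differentiable_comp (da y) (df _)).
split=> // i.
rewrite (_ : partial i _ = (fun y => (c * s) * partial i f (b + s *: y))).
  exact: IH.
apply/funext => y; rewrite /partial.
pose e : 'rV[R]_n := delta_mx ord0 i.
have h1 := @is_derive_line R n (fun y => c * f (b + s *: y)) y e 0
  (diff_derivable (dF _)).
have h2 := @is_derive_line R n f (b + s *: y) (s *: e) 0
  (diff_derivable (df _)).
have h3 : is_derive (0 : R) (1 : R) (fun t => c * f (b + s *: y + t *: (s *: e)))
    (c * 'D_(s *: e) f (b + s *: y + 0 *: (s *: e))).
  exact: is_deriveZ.
rewrite (_ : (fun t => _) = (fun t => c * f (b + s *: (y + t *: e)))) in h3; last first.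
  apply/funext => t; congr (_ * f _).
  by rewrite scalerDr addrA !scalerA (mulrC t).
have := @derive_val _ _ _ _ _ _ _ h1.
rewrite (@derive_val _ _ _ _ _ _ _ h3) !scale0r !addr0 => <-.
by rewrite !deriveE// linearZ /= mulrA.
Qed.

Lemma Cc_infty_affine n (f : 'rV[R]_n -> R) (c s : R) (b : 'rV[R]_n) : s != 0 ->
  Cc_infty f -> Cc_infty (fun y => c * f (b + s *: y)).
Proof.
move=> s0 fc; split=> [k|]; first by apply: Ck_affine; exact: fc.1.
apply: Cc_compact_support.
have [cf [M Mf]] := @Cc_comp_affine _ _ f b s s0 (Cc_infty_Cc n f fc).
split; last by exists M => x /Mf ->; rewrite mulr0.
by move=> y; apply: (@cvgMl_tmp _ _ _ (nbhs_filter y)); exact: cf.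
Qed.

Lemma convolution_partial n (f g : 'rV[R]_n -> R) (B : R) (x : 'rV[R]_n) i :
  measurable_fun setT f -> (forall y, `|f y| <= B) -> Cc_infty g ->
  is_derive x (delta_mx ord0 i) (convolution n f g) (convolution n f (partial i g) x).
Proof.
move=> mf fB gc; apply: (is_derive_convolution _ _ _ B) => //.
- exact: Cc_infty_Cc.
- by move=> z; exact: Cc_infty_derivable.
- exact: (Cc_partial n g i).
Qed.

Lemma convolution_bound n (f g : 'rV[R]_n -> R) (B : R) (x : 'rV[R]_n) :
  measurable_fun setT f -> (forall y, `|f y| <= B) -> Cc n g ->
  `|convolution n f g x| <= B * \int[leb n]_y `|g y|.
Proof.
move=> mf fB gc.
have gn := Cc_norm n g gc.
have gs := Cc_comp_sub n _ x gc.
have gns := Cc_comp_sub n _ x gn.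
rewrite -(Rintegral_sub n _ x gn) -RintegralZl//; last exact: Cc_integrable.
have iF : (leb n).-integrable setT (EFin \o (fun y => f y * g (x - y))).
  exact: (integrable_bounded_mul n f _ B).
rewrite (le_trans (le_normr_Rintegral measurableT iF))//.
apply: le_Rintegral => //.
- exact: (integrable_norm iF).
- have := integrableZl measurableT B (Cc_integrable n _ gns).
  by apply: eq_integrable.
- by move=> y _; rewrite normrM ler_wpM2r.
Qed.

Lemma mean_value_scaled n (f : 'rV[R]_n -> R) (x v : 'rV[R]_n) (t K : R) :
  (forall z, derivable f z v) -> (forall z, `|'D_v f z| <= K) ->
  `|f (x + t *: v) - f x| <= `|t| * K.
Proof.
move=> df fK.
wlog t0 : x t / 0 <= t.
  move=> H; have [t0|t0] := leP 0 t; first exact: H.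
  have := H (x + t *: v) (- t); rewrite scaleNr addrK distrC normrN; apply.
  by rewrite oppr_ge0 ltW.
have dg s : is_derive s (1 : R) (fun s => f (x + s *: v)) ('D_v f (x + s *: v)).
  exact: is_derive_line.
have [||c _] := @MVT_segment R (fun s => f (x + s *: v))
  (fun s => 'D_v f (x + s *: v)) 0 t.
- exact: t0.
- apply: derivable_within_continuous => s _; exact: ex_derive.
rewrite scale0r addr0 subr0 => ->.
by rewrite normrM mulrC ler_wpM2l.
Qed.

(** Move from [y] to [x] one coordinate at a time. *)
Lemma lipschitz_of_coords n (f : 'rV[R]_n -> R) (G : 'I_n -> R) :
  (forall i, 0 <= G i) ->
  (forall i x t, `|f (x + t *: delta_mx ord0 i) - f x| <= `|t| * G i) ->
  forall x y, `|f x - f y| <= (\sum_i G i) * enorm (x - y).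
Proof.
move=> G0 fG x y; have xE : y + (x - y) = x by rewrite addrC subrK.
rewrite -{1}xE; move: (x - y) => v {x xE}.
rewrite {1}[v]row_sum_delta mulr_suml.
rewrite (@le_trans _ _ (\sum_i `|v ord0 i| * G i))//; last first.
  by apply: ler_sum => i _; rewrite mulrC ler_wpM2l// coord_le_enorm.
elim: (index_enum _) y => [|i r IH] y; first by rewrite !big_nil addr0 subrr normr0.
rewrite !big_cons addrA; set z := y + v ord0 i *: delta_mx ord0 i.
rewrite (le_trans (ler_distD (f z) _ _))// [leRHS]addrC lerD ?IH//.
exact: fG.
Qed.

Lemma lipschitz_continuous_rV n (f : 'rV[R]_n -> R) (L : R) :
  (forall x y, `|f x - f y| <= L * enorm (x - y)) -> continuous f.
Proof.
move=> fL x; apply/(@cvgrPdist_le _ _ _ (nbhs x) (nbhs_filter x)) => e e0.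
have L0 : 0 < `|L| + 1 by rewrite ltr_wpDl.
have ed : 0 < e / (`|L| + 1) by rewrite divr_gt0.
have cx : enorm (x - y) @[y --> x] --> (0 : R).
  have -> : (0 : R) = enorm (x - x) by rewrite subrr enorm0.
  exact: (continuous_comp_sub n _ x (@continuous_enorm R n) x).
have /(@cvgrPdist_le _ _ _ (nbhs x) (nbhs_filter x))/(_ _ ed) := cx.
apply: filterS => y; rewrite sub0r normrN ger0_norm ?enorm_ge0//.
rewrite ler_pdivlMr// mulrC => h; apply: le_trans (fL _ _) (le_trans _ h).
by rewrite ler_wpM2r ?enorm_ge0// (le_trans (ler_norm L))// lerDl.
Qed.

(** The partial derivatives are convolutions of [f] with the partial derivatives
    of [g], bounded by [B] times their [L^1] norms, so the convolution is even
    Lipschitz. *)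
Lemma continuous_convolution n (f g : 'rV[R]_n -> R) (B : R) :
  measurable_fun setT f -> (forall y, `|f y| <= B) -> Cc_infty g ->
  continuous (convolution n f g).
Proof.
move=> mf fB gc.
have B0 : 0 <= B by rewrite (le_trans _ (fB 0)).
apply: (lipschitz_continuous_rV n _
  (\sum_i B * \int[leb n]_y `|partial i g y|)).
apply: lipschitz_of_coords => [i|i x t].
  by rewrite mulr_ge0//; apply: Rintegral_ge0.
apply: mean_value_scaled => z.
  have h := convolution_partial n f g B z i mf fB gc; exact: ex_derive.
have h := convolution_partial n f g B z i mf fB gc; rewrite derive_val.
by apply: convolution_bound => //; exact: Cc_partial.
Qed.

End smooth.

(** * Mollification and Lipschitz representatives *)

Section mollification.
Context {R : realType}.

Lemma mollifier_Cc_infty n (rho : 'rV[R]_n -> R) (eps : R) : 0 < eps ->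
  Cc_infty rho -> Cc_infty (mollifier rho eps).
Proof.
move=> e0 rc.
rewrite (_ : mollifier _ _ = (fun x => (eps ^+ n)^-1 * rho (0 + eps^-1 *: x))).
  by apply: Cc_infty_affine => //; rewrite invr_eq0 gt_eqF.
by apply/funext => x; rewrite /mollifier add0r.
Qed.

Section kernel.
Variables (n : nat) (rho : 'rV[R]_n -> R).
Hypotheses (rc : Cc_infty rho) (rho0 : forall x, 0 <= rho x)
  (rho1 : \int[leb n]_x rho x = 1).

(** [rho] is a probability density: averaging against it does not increase
    distances. This gives both the Lipschitz bounds and the convergence of
    mollifications. *)
Lemma average_dist (f1 f2 : 'rV[R]_n -> R) (B D : R) :
  measurable_fun setT f1 -> measurable_fun setT f2 ->
  (forall x, `|f1 x| <= B) -> (forall x, `|f2 x| <= B) ->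
  (forall z, rho z != 0 -> `|f1 z - f2 z| <= D) ->
  `|\int[leb n]_z (f1 z * rho z) - \int[leb n]_z (f2 z * rho z)| <= D.
Proof.
move=> mf1 mf2 f1B f2B fD; have rcc := Cc_infty_Cc n rho rc.
have i1 := integrable_bounded_mul n f1 rho B mf1 f1B rcc.
have i2 := integrable_bounded_mul n f2 rho B mf2 f2B rcc.
rewrite -RintegralB//.
have i12 : (leb n).-integrable setT
    (EFin \o (fun z => f1 z * rho z - f2 z * rho z)).
  exact: (integrableB measurableT i1 i2).
rewrite (le_trans (le_normr_Rintegral measurableT i12))//.
rewrite -[leRHS]mulr1 -rho1 -RintegralZl//; last exact: Cc_integrable.
apply: le_Rintegral => //.
- exact: (integrable_norm i12).
- have := integrableZl measurableT D (Cc_integrable n _ rcc).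
  by apply: eq_integrable.
- move=> z _; rewrite -mulrBl normrM (ger0_norm (rho0 z)).
  have [->|rz] := eqVneq (rho z) 0; first by rewrite !mulr0.
  by rewrite ler_wpM2r// fD.
Qed.

Lemma measurable_comp_affine (f : 'rV[R]_n -> R) (b : 'rV[R]_n) (c : R) :
  measurable_fun setT f -> measurable_fun setT (fun z : 'rV[R]_n => f (b + c *: z)).
Proof. by move=> mf; exact: (measurableT_comp mf (measurable_affine n b c)). Qed.

Lemma convolution_mollifier (f : 'rV[R]_n -> R) (B eps : R) (x : 'rV[R]_n) :
  0 < eps -> measurable_fun setT f -> (forall y, `|f y| <= B) ->
  convolution n f (mollifier rho eps) x =
  \int[leb n]_z (f (x + (- eps) *: z) * rho z).
Proof.
move=> e0 mf fB; have e1 : - eps != 0 by rewrite oppr_eq0 gt_eqF.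
have mc := mollifier_Cc_infty n rho eps e0 rc.
have mcc := Cc_infty_Cc n _ mc.
have mfa := measurable_comp_affine f x (- eps) mf.
have iA : (leb n).-integrable setT (fun z => (f (x + - eps *: z) * rho z)%:E).
  apply: (integrable_bounded_mul n (fun z => f (x + - eps *: z)) rho B) => //.
  exact: Cc_infty_Cc.
have E z : f (x + - eps *: z) * mollifier rho eps (x - (x + - eps *: z)) =
    (eps ^+ n)^-1 * (f (x + - eps *: z) * rho z).
  rewrite /mollifier opprD addNKr scaleNr opprK scalerA mulVf ?gt_eqF// scale1r.
  by rewrite mulrCA.
rewrite /convolution (Rintegral_leb_affine n x (- eps)) //.
- rewrite normrN (gtr0_norm e0).
  under eq_Rintegral do rewrite E.
  by rewrite RintegralZl// mulrA divff ?mul1r// expf_neq0// gt_eqF.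
- apply: measurable_funM => //; apply: continuous_measurable_rV.
  exact: continuous_comp_sub mcc.1.
- rewrite (_ : (fun z => _) = (fun z => ((eps ^+ n)^-1)%:E *
    (f (x + - eps *: z) * rho z)%:E)%E); first exact: integrableZl.
  by apply/funext => z; rewrite E EFinM.
Qed.

Lemma mollification_lipschitz (f : 'rV[R]_n -> R) (B L eps : R) :
  0 < eps -> measurable_fun setT f -> (forall y, `|f y| <= B) ->
  (forall x y, `|f x - f y| <= L * enorm (x - y)) ->
  forall x y, `|convolution n f (mollifier rho eps) x -
                convolution n f (mollifier rho eps) y| <= L * enorm (x - y).
Proof.
move=> e0 mf fB fL x y; rewrite !(convolution_mollifier f B)//.
apply: (average_dist _ _ B) => //; try exact: measurable_comp_affine.
move=> z _; apply: le_trans (fL _ _) _.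
by rewrite opprD addrACA subrr addr0.
Qed.

Lemma mollification_cvg (f : 'rV[R]_n -> R) (B e : R) (x : 'rV[R]_n) :
  continuous f -> (forall y, `|f y| <= B) -> 0 < e ->
  exists2 delta, 0 < delta & forall eps, 0 < eps < delta ->
    `|convolution n f (mollifier rho eps) x - f x| <= e.
Proof.
move=> cf fB e0; have mf := continuous_measurable_rV _ f cf.
have [K K0 [_ rs]] := Cc_bounded n _ (Cc_infty_Cc n rho rc).
have /(@cvgrPdist_le _ _ _ (nbhs x) (nbhs_filter x))/(_ _ e0) := cf x.
move=> /nbhs_ballP[d /= d0 dB].
exists (d / K); first by rewrite divr_gt0.
move=> eps /andP[eps0]; rewrite ltr_pdivlMr// => epsd.
have -> : f x = \int[leb n]_z (f x * rho z).
  by rewrite RintegralZl ?rho1 ?mulr1//; apply: Cc_integrable; exact: Cc_infty_Cc.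
rewrite (convolution_mollifier f B)//.
apply: (average_dist _ (cst (f x)) B) => [|//|//||z rz].
- exact: measurable_comp_affine.
- by move=> z; exact: fB.
rewrite distrC; apply: dB.
rewrite mx_norm_ball /ball_ /= opprD addNKr scaleNr opprK normrZ gtr0_norm//.
apply: le_lt_trans epsd; rewrite ler_pM2l// leNgt; apply/negP => /rs rz0.
by rewrite rz0 eqxx in rz.
Qed.

End kernel.

(** [g] need not be measurable, so the positive and negative parts of the
    integrand are bounded separately. *)
Lemma Rintegral_ae_bound n (g phi : 'rV[R]_n -> R) (G : R) : 0 <= G ->
  {ae leb n, forall x, `|g x| <= G} -> Cc n phi ->
  `|\int[leb n]_x (g x * phi x)| <= G * \int[leb n]_x `|phi x|.
Proof.
move=> G0 gG pc; have pn := Cc_norm n phi pc.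
have ip := Cc_integrable n _ pn.
have iG : (leb n).-integrable setT (fun x => (G * `|phi x|)%:E).
  by have := integrableZl measurableT G ip; apply: eq_integrable.
rewrite -RintegralZl// /Rintegral.
set h := fun x => (g x * phi x)%:E.
set k := fun x => (G * `|phi x|)%:E.
have mk : measurable_fun setT k by case/integrableP : iG.
have k0 x : (0 <= k x)%E by rewrite lee_fin mulr_ge0.
have hk : {ae leb n, forall x, (`|h x| <= k x)%E}.
  by apply: filterS gG => x gx; rewrite lee_fin normrM ler_wpM2r.
have hp : (\int[leb n]_x h^\+ x <= \int[leb n]_x k x)%E.
  apply: ae_le_integral_gen => //.
  apply: filterS hk => x; apply: le_trans; rewrite funeposE ge_max.
  by rewrite abse_ge0 lee_abs.
have hn : (\int[leb n]_x h^\- x <= \int[leb n]_x k x)%E.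
  apply: ae_le_integral_gen => //.
  apply: filterS hk => x; apply: le_trans; rewrite funenegE ge_max.
  by rewrite abse_ge0 -abseN lee_abs.
have fk : (\int[leb n]_x k x)%E \is a fin_num by exact: integrable_fin_num.
have hp0 : (0 <= \int[leb n]_x h^\+ x)%E by exact: integral_ge0.
have hn0 : (0 <= \int[leb n]_x h^\- x)%E by exact: integral_ge0.
rewrite integralE; move: fk hp hn hp0 hn0.
case: (\int[leb n]_x k x)%E => [r| |] //= _.
case: (\int[leb n]_x h^\+ x)%E => [s| |] //=.
case: (\int[leb n]_x h^\- x)%E => [t| |] //=.
rewrite !lee_fin ler_norml; lra.
Qed.

Lemma W1infty_bounded n (u : 'rV[R]_n -> R) : W1infty u -> continuous u ->
  exists B, forall x, `|u x| <= B.
Proof.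
move=> [/Linfty_bounded[M uM] _] cu; exists M => x; rewrite leNgt; apply/negP => Mx.
have [|y /=] := ae_leb_nbhs _ _ x [set y | M < `|u y|] uM.
  apply: (continuous_nbhs_gt _ (fun y => `|u y|)) => // y.
  exact: (continuous_comp (cu y) (@norm_continuous _ _ _)).
by rewrite ltNge => /negP.
Qed.

(** The mollifications of [u] are uniformly Lipschitz because their partial
    derivatives are mollifications of the bounded weak derivatives of [u]; the
    bound passes to the limit. *)
Lemma W1infty_lipschitz n (u rho : 'rV[R]_n -> R) : Cc_infty rho ->
  (forall x, 0 <= rho x) -> \int[leb n]_x rho x = 1 ->
  W1infty u -> continuous u ->
  exists L, forall x y, `|u x - u y| <= L * enorm (x - y).
Proof.
move=> rc rho0 rho1 hu cu; have [B uB] := W1infty_bounded n u hu cu.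
have mu := continuous_measurable_rV _ u cu.
case: hu => _ /choice[g hg].
have /choice[G GP] : forall i, exists G,
    0 <= G /\ {ae leb n, forall x, `|g i x| <= G}.
  move=> i; have [/Linfty_bounded[M gM] _] := hg i; exists `|M|; split=> //.
  by apply: filterS gM => x /le_trans; apply; exact: ler_norm.
exists (\sum_i G i); apply: lipschitz_of_coords => [i|i x t].
  by case: (GP i).
have [G0 gG] := GP i; have [_ gphi] := hg i.
have lip eps y s : 0 < eps ->
  `|convolution n u (mollifier rho eps) (y + s *: delta_mx ord0 i) -
    convolution n u (mollifier rho eps) y| <= `|s| * G i.
  move=> e0; have mc := mollifier_Cc_infty n rho eps e0 rc.
  apply: mean_value_scaled => z.
    have h := convolution_partial n u _ B z i mu uB mc; exact: ex_derive.
  have h := convolution_partial n u _ B z i mu uB mc; rewrite derive_val.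
  (* y |-> rho_eps (z - y), the test function in the definition of g i *)
  pose phi := fun y => 1 * mollifier rho eps (z + (-1) *: y).
  have pc : Cc_infty phi.
    by apply: Cc_infty_affine => //; rewrite oppr_eq0 oner_eq0.
  have phiE : phi = fun y => mollifier rho eps (z - y).
    by apply/funext => w; rewrite /phi mul1r scaleN1r.
  have dphi w : partial i phi w = - partial i (mollifier rho eps) (z - w).
    have h1 := @is_derive_line R n phi w (delta_mx ord0 i) 0
      (Cc_infty_derivable _ _ _ _ pc).
    have h2 := @is_derive_line R n (mollifier rho eps) (z - w)
      (- delta_mx ord0 i) 0 (Cc_infty_derivable _ _ _ _ mc).
    have := @derive_val _ _ _ _ _ _ _ h1.
    rewrite (_ : (fun t => _) = (fun t => mollifier rho eps
      (z - w + t *: - delta_mx ord0 i))); last first.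
      by apply/funext => r; rewrite phiE opprD addrA scalerN.
    rewrite (@derive_val _ _ _ _ _ _ _ h2) !scale0r !addr0 /partial => <-.
    by rewrite !deriveE ?linearN//; exact: Cc_infty_differentiable.
  have -> : convolution n u (partial i (mollifier rho eps)) z =
      \int[leb n]_y (g i y * phi y).
    have := gphi phi pc; under eq_Rintegral do rewrite dphi mulrN.
    move=> /(congr1 -%R); rewrite opprK => <-.
    rewrite -[RHS]mulN1r -RintegralZl//; last first.
      have := integrable_bounded_mul n u (fun w => partial i (mollifier rho eps) (z - w)) B mu uB (Cc_comp_sub n _ z (Cc_partial n _ i mc)).
      move=> /(integrableZl measurableT (-1)); apply: eq_integrable => // w _.
      by rewrite -EFinM mulN1r.
    by apply: eq_Rintegral => w _; rewrite mulN1r opprK.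
  rewrite (le_trans (Rintegral_ae_bound n _ _ (G i) G0 gG (Cc_infty_Cc n _ pc)))//.
  rewrite (_ : \int[leb n]_y `|phi y| = 1) ?mulr1//.
  have h0 w : 0 <= mollifier rho eps w.
    by rewrite /mollifier mulr_ge0// invr_ge0 exprn_ge0// ltW.
  transitivity (\int[leb n]_y (1 * rho y)).
    rewrite -(convolution_mollifier n rho rc (cst 1) 1 eps z)//; last first.
      by move=> w; rewrite normr1.
    by apply: eq_Rintegral => w _; rewrite phiE mul1r ger0_norm.
  by under eq_Rintegral do rewrite mul1r.
apply/ler_addgt0Pr => e e0; have e20 : 0 < e / 2 by rewrite divr_gt0.
have [d1 d10 h1] := mollification_cvg n rho rc rho0 rho1 u B (e / 2)
  (x + t *: delta_mx ord0 i) cu uB e20.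
have [d2 d20 h2] := mollification_cvg n rho rc rho0 rho1 u B (e / 2) x cu uB e20.
pose d := Num.min d1 d2 / 2.
have d0 : 0 < d by rewrite divr_gt0// lt_min d10.
have dd : d < Num.min d1 d2 by rewrite ltr_pdivrMr// mulr_natr mulr2n ltrDl lt_min d10.
move: dd; rewrite lt_min => /andP[dd1 dd2].
have := h1 d; rewrite d0 dd1 => /(_ isT); have := h2 d; rewrite d0 dd2 => /(_ isT).
have := lip d x t d0.
rewrite !ler_norml; lra.
Qed.

End mollification.

(** * The Hopf-Lax step *)

Section hamiltonian.
Context {R : realType} {n : nat}.
Variables (T : R) (H : 'rV[R]_n -> R -> 'rV[R]_n -> R).

Lemma continuous_hamiltonian x t : hypH1 T H -> 0 <= t <= T ->
  continuous (H x t).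
Proof.
move=> H1 tT p; apply/(@cvgrPdist_le _ _ _ (nbhs p) (nbhs_filter p)) => e e0.
have r0 : 0 < enorm p + 1 by rewrite ltr_wpDl ?enorm_ge0.
have [delta d0 Hd] := H1 _ r0 _ e0.
have m0 : 0 < Num.min (delta / 2) (1 / 2) by rewrite lt_min !divr_gt0.
have cp : enorm (p - q) @[q --> p] --> (0 : R).
  have -> : (0 : R) = enorm (p - p) by rewrite subrr enorm0.
  exact: (continuous_comp_sub n _ p (@continuous_enorm R n) p).
have /(@cvgrPdist_le _ _ _ (nbhs p) (nbhs_filter p))/(_ _ m0) := cp.
apply: filterS => q; rewrite sub0r normrN ger0_norm ?enorm_ge0// le_min.
move=> /andP[qd q1]; apply: ltW; apply: Hd => //.
- by rewrite ltrDl.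
- by have := enormD p (q - p); rewrite addrC subrK enormB; lra.
- by rewrite subrr enorm0.
- by rewrite subrr normr0.
- lra.
Qed.

Lemma hamiltonian_bounded r : hypH2' T H -> 0 < r -> exists2 C, 0 <= C &
  forall x t p, 0 <= t <= T -> enorm p <= r -> `|H x t p| <= C.
Proof.
move=> /(_ r) H2 /H2; set S := [set _ | _ in _] => Soo.
have hS x t p : 0 <= t <= T -> enorm p <= r ->
    (`|H x t p|%:E <= ereal_sup S)%E.
  by move=> tT pr; apply: ereal_sup_ubound; exists (x, t, p).
move: Soo hS; case: (ereal_sup S) => [c _|//|_] hS; last first.
  by exists 0 => // x t p tT pr; have := hS x t p tT pr; rewrite leeNy_eq.
exists `|c| => // x t p tT pr; have := hS x t p tT pr; rewrite lee_fin.
by move=> /le_trans; apply; exact: ler_norm.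
Qed.

Lemma hamiltonian_superlinear A : hypH4ii T H -> exists2 M, 0 <= M &
  forall x t p, 0 <= t <= T -> M < enorm p -> A * enorm p <= H x t p.
Proof.
move=> /(_ A)[M HM]; exists `|M| => // x t p tT Mp.
have p0 : 0 < enorm p by rewrite (le_lt_trans _ Mp).
have {}Mp : M < enorm p by rewrite (le_lt_trans _ Mp)// ler_norm.
have := le_trans (HM p Mp) (ereal_inf_lbound _).
move=> /(_ (H x t p / enorm p)%:E); rewrite lee_fin ler_pdivlMr//.
by apply; exists (x, t).
Qed.

(** Either growth condition makes [H] nonnegative for large [p]. *)
Lemma hamiltonian_bounded_below : hypH2' T H -> hypH4 T H -> exists2 C, 0 <= C &
  forall x t p, 0 <= t <= T -> - C <= H x t p.
Proof.
move=> H2 [_ H4].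
have [M M0 HM] : exists2 M, 0 <= M &
    forall x t p, 0 <= t <= T -> M < enorm p -> 0 <= H x t p.
  case: H4 => [[[K K0 /(_ K K0)[M HM]] _]|H4].
    exists `|M| => // x t p tT Mp.
    have p0 : 0 < enorm p by rewrite (le_lt_trans _ Mp).
    have := HM x t p tT (le_lt_trans (ler_norm M) Mp).
    rewrite ltr_norml => /andP[h _].
    have : 0 <= H x t p / enorm p by lra.
    by rewrite pmulr_lge0// invr_gt0.
  have [M M0 HM] := hamiltonian_superlinear 0 H4; exists M => // x t p tT Mp.
  by have := HM x t p tT Mp; rewrite mul0r.
have [|C C0 HC] := hamiltonian_bounded (M + 1) H2; first by rewrite ltr_wpDl.
exists C => // x t p tT; have [pM|Mp] := leP (enorm p) (M + 1).
  by have := HC x t p tT pM; rewrite ler_norml => /andP[].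
apply: (@le_trans _ _ 0); first by rewrite oppr_le0.
by apply: HM => //; rewrite (lt_trans _ Mp)// ltrDl.
Qed.

Lemma legendre_ge x t xi p :
  ((dot xi p - H x t p)%:E <= legendre H x t xi)%E.
Proof. by apply: ereal_sup_ubound; exists p. Qed.

Lemma legendre_le x t xi m :
  (forall p, ((dot xi p - H x t p)%:E <= m)%E) -> (legendre H x t xi <= m)%E.
Proof. by move=> h; apply: ge_ereal_sup => _ [p _ <-]. Qed.

(** The Lipschitz constant [alpha p] is essentially bounded in [p], and the
    resulting inequality passes from almost every [p] to all [p] by continuity
    of [H] in [p]. *)
Lemma hamiltonian_lipschitz : hypH1 T H -> hypH4i T H -> exists2 A, 0 <= A &
  forall x y t p, 0 <= t <= T -> `|H x t p - H y t p| <= A * enorm (x - y).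
Proof.
move=> H1 [_ [alpha [_ /Linfty_bounded[A aA] Ha]]].
exists `|A| => // x y t p tT; rewrite leNgt; apply/negP => h.
have cH : continuous (fun q => `|H x t q - H y t q|).
  move=> q; have c1 : {for q, continuous (fun q => H x t q - H y t q)}.
    by apply: (@cvgB _ _ _ _ (nbhs_filter q)); exact: continuous_hamiltonian.
  exact: (continuous_comp c1 (@norm_continuous _ _ _)).
have [q /=] := ae_leb_nbhs _ _ p _ aA (continuous_nbhs_gt _ _ p _ cH h).
move=> hq aq; have := lt_le_trans hq (Ha x y t q tT).
rewrite ltNge ler_wpM2r ?enorm_ge0//.
by rewrite (le_trans (ler_norm _))// (le_trans aq)// ler_norm.
Qed.

(** For a Hamiltonian of linear growth, [H] is Lipschitz in [x] uniformly in [p]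
    and so is its conjugate, even where it is infinite. For a superlinear one,
    the supremum defining the conjugate at [xi] with [|xi| <= r] may be taken
    over a ball of slopes [p] whose radius depends on [r] only, and [H] is
    uniformly Lipschitz in [x] there. *)
Lemma legendre_lipschitz r : hypH1 T H -> hypH2' T H -> hypH3 T H ->
  hypH4 T H -> exists2 A, 0 <= A & forall x y t xi, 0 <= t <= T ->
    enorm xi <= r ->
    (legendre H y t xi <= legendre H x t xi + (A * enorm (x - y))%:E)%E.
Proof.
move=> H1 H2 [eta eta0 H3] [_ [H4|H4]].
  have [A A0 HA] := hamiltonian_lipschitz H1 H4.
  exists A => // x y t xi tT _; apply: legendre_le => p.
  apply: (@le_trans _ _ ((dot xi p - H x t p)%:E + (A * enorm (x - y))%:E)%E).
    by rewrite -EFinD lee_fin; have := HA x y t p tT; rewrite ler_norml; lra.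
  by rewrite leeD2r// legendre_ge.
have [M M0 HM] := hamiltonian_superlinear (r + 1) H4.
have [C C0 HC] := hamiltonian_bounded 1 H2 ltr01.
pose P := Num.max M C.
have P0 : 0 <= P by rewrite le_max M0.
have A0 : 0 <= eta * (1 + P) by apply: mulr_ge0; [exact: ltW|exact: addr_ge0].
exists (eta * (1 + P)) => // x y t xi tT xir; apply: legendre_le => p.
have [pP|Pp] := leP (enorm p) P.
  apply: (@le_trans _ _
      ((dot xi p - H x t p)%:E + (eta * (1 + P) * enorm (x - y))%:E)%E).
    rewrite -EFinD lee_fin; have := H3 x y t p tT; rewrite ler_norml.
    have : eta * (1 + enorm p) * enorm (x - y) <= eta * (1 + P) * enorm (x - y).
      by rewrite ler_wpM2r ?enorm_ge0// ler_pM2l// lerD2l.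
    lra.
  by rewrite leeD2r// legendre_ge.
(* large slopes do worse than p = 0 *)
apply: (@le_trans _ _ ((dot xi 0 - H x t 0)%:E + 0)%E); last first.
  by rewrite leeD ?legendre_ge// lee_fin mulr_ge0 ?enorm_ge0.
move: Pp; rewrite gt_max => /andP[Mp Cp].
rewrite adde0 lee_fin -(scale0r (0 : 'rV[R]_n)) dotZr mul0r scale0r.
have := HC x t 0 tT; rewrite enorm0 => /(_ ler01); rewrite ler_norml.
have := HM y t p tT Mp; have := dot_le xi p.
have : enorm xi * enorm p <= r * enorm p by rewrite ler_wpM2r ?enorm_ge0.
lra.
Qed.

(** The conjugate is controlled in [x] only for bounded [xi]. Bounded data need
    no other [xi]: the conjugate at [xi] is at least [|xi| - C1], where [C1]
    bounds [|H|] on slopes of norm at most [1], so that beyond the radius [r]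
    below [xi] does worse than [0]. That radius grows like [1 / h], which is
    harmless for a fixed time step. *)
Lemma hopf_lax_step (h t B L : R) (u : 'rV[R]_n -> R) :
  hypH1 T H -> hypH2' T H -> hypH3 T H -> hypH4 T H ->
  0 < h -> 0 <= t <= T ->
  (forall x, `|u x| <= B) ->
  (forall x y, `|u x - u y| <= L * enorm (x - y)) ->
  exists v B' L', [/\ forall x, ereal_inf
      [set ((u (x - h *: xi))%:E + h%:E * legendre H x t xi)%E
       | xi in [set: 'rV[R]_n]] = (v x)%:E,
    forall x, `|v x| <= B' &
    forall x y, `|v x - v y| <= L' * enorm (x - y)].
Proof.
move=> H1 H2 H3 H4 h0 tT uB uL.
pose E x xi := ((u (x - h *: xi)%R)%:E + h%:E * legendre H x t xi)%E.
pose V x := ereal_inf [set E x xi | xi in [set: 'rV[R]_n]].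
have h0' : (0 <= h%:E)%E by rewrite lee_fin ltW.
have [C C0 HC] := hamiltonian_bounded_below H2 H4.
have [C1 C10 HC1] := hamiltonian_bounded 1 H2 ltr01.
have B0 : 0 <= B by rewrite (le_trans _ (uB 0)).
have Elow x xi p : ((- B + h * (dot xi p - H x t p))%:E <= E x xi)%E.
  rewrite EFinD EFinM leeD//.
    by rewrite lee_fin; have := uB (x - h *: xi); rewrite ler_norml => /andP[].
  by rewrite lee_pmul2l ?lte_fin ?fin_numE//; exact: legendre_ge.
have Vup x : (V x <= (B + h * C)%:E)%E.
  apply: (le_trans (ereal_inf_lbound (ex_intro2 _ _ 0 I erefl))).
  rewrite EFinD EFinM leeD//.
    by rewrite lee_fin (le_trans (ler_norm _)).
  rewrite lee_pmul2l ?lte_fin ?fin_numE//; apply: legendre_le => p.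
  rewrite lee_fin -(scale0r (0 : 'rV[R]_n)) dotZl mul0r.
  by have := HC x t p tT; lra.
have Vlow x : ((- B - h * C1)%:E <= V x)%E.
  apply: le_ereal_inf_tmp => _ [xi _ <-]; apply: le_trans (Elow x xi 0).
  rewrite lee_fin lerD2l -mulrN ler_pM2l//.
  rewrite -(scale0r (0 : 'rV[R]_n)) dotZr mul0r scale0r.
  have := HC1 x t 0 tT; rewrite enorm0 => /(_ ler01); rewrite ler_norml; lra.
have Vfin x : V x = (fine (V x))%:E.
  rewrite fineK// fin_numE; apply/andP; split; apply/eqP => Vx.
    by have := Vlow x; rewrite Vx leeNy_eq.
  by have := Vup x; rewrite Vx leye_eq.
pose r := (B + B) / h + C + C1.
have r0 : 0 <= r by rewrite !addr_ge0// divr_ge0 ?addr_ge0// ltW.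
have [A A0 HA] := legendre_lipschitz r H1 H2 H3 H4.
have L'E (x y : 'rV[R]_n) : ((L * enorm (x - y))%:E + h%:E * (A * enorm (x - y))%:E =
    ((L + h * A) * enorm (x - y))%:E)%E.
  by rewrite -EFinM -EFinD mulrDl mulrA.
have LA0 (x y : 'rV[R]_n) : 0 <= (L + h * A) * enorm (x - y).
  have h1 : 0 <= h * A * enorm (x - y) by rewrite !mulr_ge0 ?enorm_ge0// ltW.
  have := le_trans (normr_ge0 _) (uL x y); rewrite mulrDl; lra.
have VE x y xi : (V y <= E x xi + ((L + h * A) * enorm (x - y))%:E)%E.
  have [xir|rxi] := leP (enorm xi) r.
    apply: (le_trans (ereal_inf_lbound (ex_intro2 _ _ xi I erefl))).
    apply: (@le_trans _ _ ((u (x - h *: xi))%:E + (L * enorm (x - y))%:E +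
        h%:E * (legendre H x t xi + (A * enorm (x - y))%:E))%E).
      rewrite leeD//; last by rewrite lee_pmul2l ?lte_fin ?fin_numE// HA.
      rewrite -EFinD lee_fin; have := uL (x - h *: xi) (y - h *: xi).
      have -> : x - h *: xi - (y - h *: xi) = x - y by rewrite opprB addrA subrK.
      rewrite enormB distrC ler_norml; lra.
    by rewrite muleDr ?fin_num_adde_defl// addeACA L'E.
  apply: le_trans (Vup y) _.
  apply: (@le_trans _ _ (E x xi)); last by rewrite leeDl// lee_fin.
  have xi0 : 0 < enorm xi by exact: le_lt_trans rxi.
  apply: le_trans (Elow x xi ((enorm xi)^-1 *: xi)).
  rewrite lee_fin dotZr -sqr_enorm expr2 mulKf ?gt_eqF//.
  have : `|H x t ((enorm xi)^-1 *: xi)| <= C1.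
    apply: HC1 => //; rewrite enormZ ger0_norm ?invr_ge0 ?enorm_ge0//.
    by rewrite mulVf// gt_eqF.
  rewrite ler_norml => /andP[_ hH].
  have hr : h * r = B + B + h * C + h * C1.
    by rewrite /r !mulrDr mulrCA divff ?mulr1 ?gt_eqF//.
  have : h * (r - C1) <= h * (enorm xi - H x t ((enorm xi)^-1 *: xi)).
    rewrite ler_pM2l//; lra.
  by rewrite mulrBr hr; lra.
have VL x y : fine (V y) - fine (V x) <= (L + h * A) * enorm (x - y).
  rewrite -lee_fin EFinB -!Vfin leeBlDr//; last by rewrite Vfin.
  rewrite -leeBlDl//.
  apply: le_ereal_inf_tmp => _ [xi _ <-].
  by rewrite leeBlDr// VE.
exists (fun x => fine (V x)), (B + h * C + h * C1), (L + h * A); split.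
- exact: Vfin.
- move=> x; have := Vup x; have := Vlow x; rewrite Vfin !lee_fin ler_norml.
  have hC0 : 0 <= h * C by rewrite mulr_ge0// ltW.
  have hC10 : 0 <= h * C1 by rewrite mulr_ge0// ltW.
  by move=> h1 h2; apply/andP; split; lra.
- move=> x y; rewrite ler_norml; have := VL x y; have := VL y x.
  rewrite (enormB y); lra.
Qed.

End hamiltonian.

(** * The implicit Euler scheme *)

Section implicit_scheme.
Context {R : realType} {d : nat}.
Variables (N : nat) (h C : R) (b : nat -> 'rV[R]_d -> 'rV[R]_d).
Hypotheses (h0 : 0 < h) (Ch : C * h < 1).
Hypothesis cb : forall n, (n < N)%N -> continuous (b n.+1).
Hypothesis mb : forall n x y, (n < N)%N ->
  dot (b n.+1 x - b n.+1 y) (x - y) <= C * enorm (x - y) ^+ 2.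

Definition euler (x : 'rV[R]_d) (X : 'I_N.+1 -> 'rV[R]_d) :=
  X ord0 = x /\ forall n : 'I_N, X (lift ord0 n) =
    X (widen_ord (leqnSn N) n) + h *: b n.+1 (X (lift ord0 n)).

Lemma euler_monotone n : (n < N)%N ->
  strongly_monotone d (1 - C * h) (fun x => x - h *: b n.+1 x).
Proof.
move=> nN x y; rewrite (_ : _ - _ - _ = (x - y) - h *: (b n.+1 x - b n.+1 y)).
  rewrite dotBl dotZl -sqr_enorm.
  have : h * dot (b n.+1 x - b n.+1 y) (x - y) <= h * (C * enorm (x - y) ^+ 2).
    by rewrite ler_pM2l// mb.
  lra.
by apply/rowP => i; rewrite !mxE; ring.
Qed.

Lemma euler_inordS x X : euler x X -> forall k, (k < N)%N ->
  X (inord k.+1) = X (inord k) + h *: b k.+1 (X (inord k.+1)).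
Proof.
move=> [_ EX] k kN; have := EX (Ordinal kN).
have -> : lift ord0 (Ordinal kN) = inord k.+1.
  by apply: val_inj; rewrite /= inordK.
have -> // : widen_ord (leqnSn N) (Ordinal kN) = inord k.
by apply: val_inj; rewrite /= inordK// ltnS ltnW.
Qed.

Lemma euler_inord0 x X : euler x X -> X (inord 0) = x.
Proof. by move=> [<- _]; congr X; apply: val_inj; rewrite /= inordK. Qed.

(** Each step inverts a map that multiplies distances by [1 - C h] at least. The
    maximum with [1] makes the bound nondecreasing in the number of steps, also
    for negative [C]. *)
Lemma euler_contraction x y X Y : euler x X -> euler y Y ->
  forall n : 'I_N.+1,
    enorm (X n - Y n) <= (Num.max 1 (1 - C * h)^-1) ^+ N * enorm (x - y).
Proof.
move=> EX EY n; have c0 : 0 < 1 - C * h by rewrite subr_gt0.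
set K := Num.max _ _; have K1 : 1 <= K by rewrite le_max lexx.
have K0 : 0 <= K by rewrite (le_trans ler01).
suff H k : (k <= N)%N ->
    enorm (X (inord k) - Y (inord k)) <= K ^+ k * enorm (x - y).
  have := H n (ltn_ord n); rewrite inord_val => /le_trans; apply.
  by rewrite ler_wpM2r ?enorm_ge0// ler_weXn2l// -ltnS.
elim: k => [_|k IH kN].
  by rewrite expr0 mul1r (euler_inord0 x X EX) (euler_inord0 y Y EY).
have := strongly_monotone_expand _ _ _ (X (inord k.+1)) (Y (inord k.+1))
  (euler_monotone k kN).
rewrite {2}(euler_inordS x X EX k kN) {2}(euler_inordS y Y EY k kN) !addrK.
rewrite mulrC -ler_pdivlMr// => /le_trans; apply.
rewrite mulrC exprS -mulrA.
apply: (@le_trans _ _ (K * enorm (X (inord k) - Y (inord k)))).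
  by rewrite ler_wpM2r ?enorm_ge0// le_max lexx orbT.
by rewrite ler_wpM2l// IH// ltnW.
Qed.

Lemma euler_unique x X Y : euler x X -> euler x Y -> X = Y.
Proof.
move=> EX EY; apply/funext => n; apply/eqP; rewrite -subr_eq0; apply/eqP.
apply: enorm_eq0; apply/eqP; rewrite eq_le enorm_ge0 andbT.
by have := euler_contraction x x X Y EX EY n; rewrite subrr enorm0 mulr0.
Qed.

Lemma euler_exists x : exists X, euler x X.
Proof.
have c0 : 0 < 1 - C * h by rewrite subr_gt0.
have /choice[S HS] : forall n, exists S : 'rV[R]_d -> 'rV[R]_d, (n < N)%N ->
    forall y, S y - h *: b n.+1 (S y) = y.
  move=> n; have [nN|Nn] := boolP (n < N)%N; last by exists id.
  have cF : continuous (fun x : 'rV[R]_d => x - h *: b n.+1 x).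
    move=> y; apply: (@cvgB _ _ _ _ (nbhs_filter y)); first exact: cvg_id.
    apply: (@cvgZr _ _ _ _ (nbhs_filter y)); exact: cb.
  have := strongly_monotone_surj _ _ _ c0 cF (euler_monotone n nN).
  by move=> /choice[S HS]; exists S.
pose Z := fix Z n := if n is n'.+1 then S n' (Z n') else x.
exists (fun n => Z n); split=> // n.
by have /eqP := HS n (ltn_ord n) (Z n); rewrite subr_eq => /eqP.
Qed.

Lemma euler_increment M x X : (forall n x, (n < N)%N -> enorm (b n.+1 x) <= M) ->
  euler x X -> forall n m : 'I_N.+1,
    enorm (X n - X m) <= h * M * `|n%:R - m%:R|.
Proof.
move=> bM EX n m.
wlog nm : n m / (m <= n)%N.
  move=> H; have [/H//|/ltnW/H] := leqP m n; by rewrite enormB distrC.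
suff H k : (m + k <= N)%N -> enorm (X (inord (m + k)) - X m) <= h * M * k%:R.
  have := H (n - m)%N; rewrite subnKC// inord_val natrB// => H'.
  by rewrite ger0_norm ?subr_ge0 ?ler_nat// H'// -ltnS.
elim: k => [_|k IH kN].
  by rewrite addn0 inord_val subrr enorm0 mulr0.
rewrite addnS in kN *; rewrite (euler_inordS x X EX _ kN) addrAC.
apply: le_trans (enormD _ _) _; rewrite -natr1 mulrDr mulr1; apply: lerD.
  by apply: IH; exact: ltnW.
by rewrite enormZ gtr0_norm// ler_pM2l//; exact: bM.
Qed.

End implicit_scheme.

(** * Bounds on gradients and velocities *)

Section gradients.
Context {R : realType} {d : nat}.

Lemma derive_lipschitz (f : 'rV[R]_d -> R) (L : R) (x v : 'rV[R]_d) :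
  derivable f x v -> (forall x y, `|f x - f y| <= L * enorm (x - y)) ->
  `|'D_v f x| <= L * enorm v.
Proof.
move=> df fL.
have cn : `|h^-1 *: ((f \o shift x) (h *: v) - f x)| @[h --> 0^'] --> `|'D_v f x|.
  exact: cvg_norm df.
rewrite -(cvg_lim _ cn)//; apply: limr_le; first by apply/cvg_ex; eexists; exact: cn.
apply: filterS (nbhs_dnbhs_neq (0 : R)) => h hn0 /=.
rewrite normrM normfV ler_pdivrMl ?normr_gt0//.
by rewrite (le_trans (fL _ _))// addrK enormZ mulrCA.
Qed.

Lemma enorm_grad_le (f : 'rV[R]_d -> R) (L : R) (x : 'rV[R]_d) :
  (forall i, derivable f x (delta_mx ord0 i)) ->
  (forall x y, `|f x - f y| <= L * enorm (x - y)) ->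
  enorm (grad f x) <= \sum_(i < d) L * enorm (delta_mx ord0 i : 'rV[R]_d).
Proof.
move=> df fL; apply: le_trans (enorm_le_sum _) _; apply: ler_sum => i _.
by rewrite mxE derive_lipschitz.
Qed.

(** The essential bound on [a] holds everywhere by continuity; the strict
    inequality on [p] keeps the region where it is used open. *)
Lemma velocity_bounded (a : 'rV[R]_d -> 'rV[R]_d -> 'rV[R]_d) (r : R) :
  hypA1 a -> continuous (fun z : 'rV[R]_d * 'rV[R]_d => a z.1 z.2) -> 0 < r ->
  exists M, forall x p, enorm p < r -> enorm (a x p) <= M.
Proof.
move=> /(_ r) A1 ca r0; have /Linfty_bounded[M aM] := A1 r0.
exists M => x p pr; rewrite leNgt; apply/negP => Mx.
pose U := [set z : 'rV[R]_d * 'rV[R]_d | M < enorm (a z.1 z.2)] `&`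
  [set z | enorm z.2 < r].
have nU : nbhs (x, p) U.
  apply: open_nbhs_nbhs; split=> //; apply: openI.
    rewrite (_ : mkset _ = (fun z : 'rV[R]_d * 'rV[R]_d => enorm (a z.1 z.2)) @^-1`
      [set y | M < y])//.
    apply: open_comp => [z _|]; last exact: open_gt.
    exact: (continuous_comp (ca z) (@continuous_enorm _ _ _)).
  rewrite (_ : mkset _ = (fun z : 'rV[R]_d * 'rV[R]_d => enorm z.2) @^-1`
    [set y | y < r])//.
  apply: open_comp => [z _|]; last exact: open_lt.
  exact: (continuous_comp (@cvg_snd _ _ _ _ (nbhs_filter _)) (@continuous_enorm _ _ _)).
have [[y q] [/= My qr]] := ae_leb2_nbhs _ _ (x, p) U aM nU.
rewrite indicE mem_set// mulr1 ger0_norm ?enorm_ge0//.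
by rewrite leNgt My.
Qed.

End gradients.

Section values.
Context {R : realType} {d : nat}.
Variables (T : R) (H : 'rV[R]_d -> R -> 'rV[R]_d -> R) (u0 : 'rV[R]_d -> R).
Variable N : nat.
Hypotheses (T0 : 0 < T) (N0 : (0 < N)%N).
Hypotheses (H1 : hypH1 T H) (H2 : hypH2' T H) (H3 : hypH3 T H) (H4 : hypH4 T H).

Lemma step_gt0 : 0 < step T N.
Proof. by rewrite divr_gt0// ltr0n. Qed.

Lemma time_itv n : (n <= N)%N -> 0 <= n%:R * step T N <= T.
Proof.
move=> nN; rewrite mulr_ge0// ?(ltW step_gt0)//= /step mulrCA.
by rewrite ger_pMr// ler_pdivrMr ?ltr0n// mul1r ler_nat.
Qed.

Lemma discrete_value_lipschitz B0 L0 n : (n <= N)%N ->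
  (forall x, `|u0 x| <= B0) ->
  (forall x y, `|u0 x - u0 y| <= L0 * enorm (x - y)) ->
  exists u B L, [/\ forall x, discrete_value T H u0 N n x = (u x)%:E,
    forall x, `|u x| <= B & forall x y, `|u x - u y| <= L * enorm (x - y)].
Proof.
move=> + uB uL; elim: n => [_|n IH nN]; first by exists u0, B0, L0.
have [u [B [L [uE uB' uL']]]] := IH (ltnW nN).
have [v [B' [L' [vE vB vL]]]] := hopf_lax_step T H (step T N)
  (n%:R * step T N) B L u H1 H2 H3 H4 step_gt0 (time_itv n (ltnW nN)) uB' uL'.
exists v, B', L'; split=> // x; rewrite -vE /=; congr ereal_inf.
by apply: eq_imagel => xi _; rewrite uE.
Qed.

Lemma mollified_valueE (rho u : 'rV[R]_d -> R) (eps : R) n :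
  (forall x, discrete_value T H u0 N n x = (u x)%:E) ->
  mollified_value T H u0 rho N eps n = convolution d u (mollifier rho eps).
Proof.
move=> uE; apply/funext => x; congr fine; apply: eq_integral => y _.
by rewrite uE EFinM.
Qed.

End values.

Section gradient_values.
Context {R : realType} {d : nat}.
Variables (T : R) (H : 'rV[R]_d -> R -> 'rV[R]_d -> R) (u0 rho : 'rV[R]_d -> R).
Variable N : nat.
Hypotheses (T0 : 0 < T) (N0 : (0 < N)%N).
Hypotheses (H1 : hypH1 T H) (H2 : hypH2' T H) (H3 : hypH3 T H) (H4 : hypH4 T H).
Hypotheses (rc : Cc_infty rho) (rho0 : forall x, 0 <= rho x)
  (rho1 : \int[leb d]_x rho x = 1).
Hypotheses (hu0 : W1infty u0) (cu0 : continuous u0).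

(** The Lipschitz constant of [u^n] bounds the gradients of all its
    mollifications, whatever [eps]; their continuity comes from the smoothness
    of the kernel. *)
Lemma mollified_gradient n : (n <= N)%N -> exists G, forall eps, 0 < eps ->
  let Du := grad (mollified_value T H u0 rho N eps n) in
  continuous Du /\ forall x, enorm (Du x) <= G.
Proof.
move=> nN; have [B0 u0B] := W1infty_bounded d u0 hu0 cu0.
have [L0 u0L] := W1infty_lipschitz d u0 rho rc rho0 rho1 hu0 cu0.
have [u [B [L [uE uB uL]]]] :=
  discrete_value_lipschitz T H u0 N T0 N0 H1 H2 H3 H4 B0 L0 n nN u0B u0L.
have mu := continuous_measurable_rV d u (lipschitz_continuous_rV d u L uL).
exists (\sum_(i < d) L * enorm (delta_mx ord0 i : 'rV[R]_d)) => eps e0.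
rewrite (mollified_valueE T H u0 N rho u eps n uE).
have mc := mollifier_Cc_infty d rho eps e0 rc.
have dconv x i := convolution_partial d u _ B x i mu uB mc.
split=> x; last first.
  apply: enorm_grad_le => [i|]; first by have h := dconv x i; exact: ex_derive.
  exact: (mollification_lipschitz d rho rc rho0 rho1 u B L eps).
apply: (@cvg_row _ _ _ (nbhs x) (nbhs_filter x)) => i.
have E y : grad (convolution d u (mollifier rho eps)) y ord0 i =
    convolution d u (partial i (mollifier rho eps)) y.
  by rewrite mxE /partial; have h := dconv y i; exact: derive_val.
rewrite E; under eq_fun do rewrite E.
apply: (continuous_convolution d u _ B) => //.
exact: Cc_infty_partial.
Qed.

Lemma mollified_gradient_bounded : exists G, forall eps n x, 0 < eps ->
  (n <= N)%N -> enorm (grad (mollified_value T H u0 rho N eps n) x) <= G.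
Proof.
have /choice[G HG] : forall i : 'I_N.+1, exists G, forall eps, 0 < eps ->
    forall x, enorm (grad (mollified_value T H u0 rho N eps i) x) <= G.
  move=> i; have [G HG] := mollified_gradient i (ltn_ord i).
  by exists G => eps /HG[].
exists (\sum_i `|G i|) => eps n x e0 nN; rewrite -ltnS in nN.
apply: le_trans (HG (Ordinal nN) eps e0 x) _.
rewrite (bigD1 (Ordinal nN))//= (le_trans (ler_norm _))// lerDl.
exact: sumr_ge0.
Qed.

End gradient_values.

Theorem lemma3p6 (R : realType) (d : nat) (hd : (0 < d)%N) (T : R) (hT : 0 < T)
    (H : 'rV[R]_d -> R -> 'rV[R]_d -> R)
    (a : 'rV[R]_d -> 'rV[R]_d -> 'rV[R]_d)
    (rho : 'rV[R]_d -> R) (hrho : Cc_infty rho) (hrho0 : forall x, 0 <= rho x)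
    (hrho1 : \int[leb d]_x rho x = 1)
    (u0 : 'rV[R]_d -> R) (hu0 : W1infty u0) (hu0c : continuous u0)
    (hH1 : hypH1 T H) (hH2 : hypH2' T H) (hH3 : hypH3 T H) (hH4 : hypH4 T H)
    (hA1 : hypA1 a)
    (hac : continuous (fun z : 'rV[R]_d * 'rV[R]_d => a z.1 z.2))
    (C : R) (N : nat) (hN : (0 < N)%N)
    (hC : forall (eps : R) (n : nat) (x y : 'rV[R]_d),
        0 < eps -> (n <= N)%N ->
        let Du := grad (mollified_value T H u0 rho N eps n) in
        dot (a x (Du x) - a y (Du y)) (x - y) <= C * enorm (x - y) ^+ 2)
    (hCh : C * step T N < 1) :
  (forall (eps : R) (x : 'rV[R]_d), 0 < eps ->
     exists! X : 'I_N.+1 -> 'rV[R]_d, implicit_euler T H u0 rho a eps x X) /\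
  (forall r : R, exists M : R, forall (eps : R) (x : 'rV[R]_d)
       (X : 'I_N.+1 -> 'rV[R]_d),
     0 < eps -> enorm x <= r -> implicit_euler T H u0 rho a eps x X ->
     forall n, enorm (X n) <= M) /\
  (exists L : R, forall (eps : R) (x y : 'rV[R]_d)
       (X Y : 'I_N.+1 -> 'rV[R]_d),
     0 < eps -> implicit_euler T H u0 rho a eps x X ->
     implicit_euler T H u0 rho a eps y Y ->
     forall n m, enorm (X n - Y m) <= L * (enorm (x - y) + `|n%:R - m%:R|)).
Proof.
have h0 : 0 < step T N := step_gt0 T N hT hN.
pose b eps n x := a x (grad (mollified_value T H u0 rho N eps n) x).
have mb eps : 0 < eps -> forall n x y, (n < N)%N ->
    dot (b eps n.+1 x - b eps n.+1 y) (x - y) <= C * enorm (x - y) ^+ 2.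
  by move=> e0 n x y nN; exact: hC.
have [G GP] := mollified_gradient_bounded T H u0 rho N hT hN hH1 hH2 hH3 hH4
  hrho hrho0 hrho1 hu0 hu0c.
have G0 : 0 <= G by apply: le_trans (GP 1 0%N 0 ltr01 (leq0n _)); exact: enorm_ge0.
have [|M aM] := velocity_bounded a (G + 1) hA1 hac; first by rewrite ltr_wpDl.
have bM eps : 0 < eps -> forall n x, (n < N)%N -> enorm (b eps n.+1 x) <= M.
  move=> e0 n x nN; apply: aM; rewrite (le_lt_trans (GP eps _ _ e0 nN))//.
  by rewrite ltrDl.
have M0 : 0 <= M by apply: le_trans (bM 1 ltr01 0%N 0 hN); exact: enorm_ge0.
split; [|split].
- move=> eps x e0.
  have cb n : (n < N)%N -> continuous (b eps n.+1).
    move=> nN y.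
    have [_ /(_ eps e0)[cDu _]] := mollified_gradient T H u0 rho N hT hN hH1 hH2
      hH3 hH4 hrho hrho0 hrho1 hu0 hu0c n.+1 nN.
    have cp : {for y, continuous (fun y : 'rV[R]_d =>
        (y, grad (mollified_value T H u0 rho N eps n.+1) y))}.
      exact: (@cvg_pair _ _ _ (nbhs y) (nbhs y) _ (nbhs_filter y) (nbhs_filter y)
        (nbhs_filter _) id _ (@cvg_id _ _) (cDu y)).
    exact: (continuous_comp cp (hac _)).
  have [X EX] := euler_exists N _ C (b eps) h0 hCh cb (mb eps e0) x.
  exists X; split=> // Y EY.
  exact: (euler_unique N _ C (b eps) h0 hCh (mb eps e0) x).
- move=> r; exists (r + step T N * M * N%:R) => eps x X e0 xr EX n.
  have := euler_increment N _ (b eps) h0 M x X (bM eps e0) EX n ord0.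
  rewrite subr0 ger0_norm// => Xn.
  have X0 : X ord0 = x by case: EX.
  have := enormD (X n - X ord0) (X ord0); rewrite subrK => /le_trans; apply.
  rewrite addrC lerD ?X0// -X0 (le_trans Xn)//.
  apply: ler_wpM2l; first by rewrite mulr_ge0// ltW.
  by rewrite ler_nat -ltnS ltn_ord.
- pose K := (Num.max 1 (1 - C * step T N)^-1) ^+ N.
  have K0 : 0 <= K by rewrite exprn_ge0// le_max ler01.
  have hM0 : 0 <= step T N * M by rewrite mulr_ge0// ltW.
  exists (K + step T N * M) => eps x y X Y e0 EX EY n m.
  have := enormD (X n - Y n) (Y n - Y m); rewrite addrA subrK => /le_trans; apply.
  have := euler_contraction N _ C (b eps) h0 hCh (mb eps e0) x y X Y EX EY n.
  have := euler_increment N _ (b eps) h0 M y Y (bM eps e0) EY n m.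
  rewrite -/K => h1 h2.
  have p1 : 0 <= step T N * M * enorm (x - y) by rewrite mulr_ge0 ?enorm_ge0.
  have p2 : 0 <= K * `|n%:R - m%:R| by rewrite mulr_ge0.
  rewrite mulrDl !mulrDr; lra.
Qed.
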